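(* Let $\mathcal{P}$ be an improperly self-dual chiral $4$-polytope of type $\{p,q,p\}$, let $\Phi$ be its base flag, let $\sigma_1,\sigma_2,\sigma_3$ be the distinguished generators of $\Gamma(\mathcal{P})$ with respect to $\Phi$, and let $\overline{\Gamma}(\mathcal{P})$ be the extended group of $\mathcal{P}$. Let $\delta$ be the duality of $\mathcal{P}$ with $\Phi\delta=\Phi^{0}$, put $\kappa_1:=\delta$ and $\kappa_2:=\sigma_1\sigma_2\delta^{-1}$, and let $\Lambda:=\langle\kappa_1,\kappa_2\rangle\leq\overline{\Gamma}(\mathcal{P})$. Then $\Lambda$ is the automorphism group of a chiral $3$-polytope $\mathcal{M}$ of type $\{4,2q\mid p\}$, and $\Lambda=\overline{\Gamma}(\mathcal{P})$.
   Context: Polytopes. An (abstract) $n$-polytope is a partially ordered set $\mathcal{P}$ with a strictly monotone rank function with range $\{-1,0,\dots,n\}$ such that: there are a smallest face $F_{-1}$ (rank $-1$) and a greatest face $F_n$ (rank $n$); every flag (maximal chain) has exactly $n+2$ faces; $\mathcal{P}$ is strongly flag-connected, i.e. any two flags $\Phi,\Psi$ can be joined by a sequence of flags $\Phi=\Phi_0,\dots,\Phi_k=\Psi$ with $\Phi_{i-1},\Phi_i$ differing in just one face and $\Phi\cap\Psi\subseteq\Phi_i$ for all $i$; and whenever $F\le G$ with ranks $j-1$ and $j+1$ there are exactly two $j$-faces $H$ with $F\le H\le G$. For a flag $\Phi$, $\Phi^i$ ($0\le i\le n-1$) is the unique flag differing from $\Phi$ exactly in the face of rank $i$, and $\Phi^{i_1,\dots,i_k}:=(\Phi^{i_1,\dots,i_{k-1}})^{i_k}$.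 For faces $F\le G$, the section $G/F$ is $\{H\mid F\le H\le G\}$. Groups. $\Gamma(\mathcal{P})$ is the group of automorphisms (order-preserving bijections). A duality is an order-reversing bijection $\mathcal{P}\to\mathcal{P}$; $\mathcal{P}$ is self-dual if it has a duality, and then the extended group $\overline{\Gamma}(\mathcal{P})$ is the group of all automorphisms and dualities. All these maps act on the right (products are read left to right). A duality sends the $j$-face of a flag to the $(n-1-j)$-face of the image flag. Chirality. $\mathcal{P}$ is regular if $\Gamma(\mathcal{P})$ is transitive on flags. $\mathcal{P}$ (rank $n\ge3$) is chiral if it is not regular but for some base flag $\Phi=\{F_{-1},F_0,\dots,F_n\}$ there are automorphisms $\sigma_1,\dots,\sigma_{n-1}$ such that $\sigma_i$ fixes all faces in $\Phi\setminus\{F_{i-1},F_i\}$ and cyclically permutes consecutive $i$-faces of $\mathcal{P}$ in the rank-2 section $F_{i+1}/F_{i-2}$; they are chosen so that $\Phi\sigma_i=\Phi^{i,i-1}$ and are called the distinguished generators (they generate $\Gamma(\mathcal{P})$). Equivalently, $\Gamma(\mathcal{P})$ has exactly two flag orbits, with adjacent flags always in distinct orbits. The type of $\mathcal{P}$ is $\{p_1,\dots,p_{n-1}\}$, where $p_i$ is the order of $\sigma_i$. A self-dual chiral polytope is improperly self-dual if its dualities map each flag to a flag (in reverse order) in the other orbit under $\Gamma(\mathcal{P})$; in this case a unique duality $\delta$ with $\Phi\delta=\Phi^0$ exists. Holes. A $3$-polytope gives rise to a map on a surface. A $j$-hole is an edge-path which leaves each vertex by the $j$-th edge from the one by which it entered,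 always in the same sense (in some local orientation). For a chiral $3$-polytope with distinguished generators $\sigma_1,\sigma_2$ the length of a $j$-hole is the order of $\sigma_1\sigma_2^{1-j}$. A chiral $3$-polytope is of type $\{a,b\mid h\}$ if it is of type $\{a,b\}$ and its $2$-holes have length $h$ (i.e. $\sigma_1\sigma_2^{-1}$ has order $h$). *)

(* Defs.v *)
From HB Require Import structures.
From mathcomp Require Import all_boot all_order all_algebra.
From mathcomp Require Import boolp classical_sets functions cardinality.

Set Implicit Arguments.
Unset Strict Implicit.
Unset Printing Implicit Defensive.

Import Order.TTheory.
Local Open Scope classical_set_scope.

Section Posets.
Context {d : Order.disp_t} {P : porderType d}.

Definition is_flag (A : set P) : Prop :=
  total_on A (fun F G => (F <= G)%O) /\
  forall B : set P, total_on B (fun F G => (F <= G)%O) -> A `<=` B -> B = A.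

(* Monotonicity is required in both directions, so that the inverse of an
   automorphism (resp. duality) is again one. *)
Definition is_automorphism (f : P -> P) : Prop :=
  bijective f /\ forall F G, (f F <= f G)%O = (F <= G)%O.

Definition is_duality (f : P -> P) : Prop :=
  bijective f /\ forall F G, (f F <= f G)%O = (G <= F)%O.

Definition is_ext (f : P -> P) : Prop := is_automorphism f \/ is_duality f.

End Posets.

(* The group of all automorphisms and dualities; it is the extended group when
   P is self-dual. *)
Definition extgroup {d : Order.disp_t} (P : porderType d) : Type :=
  {f : P -> P | `[< is_ext f >]}.

#[warning="-redundant-canonical-projection"]
HB.instance Definition _ (d : Order.disp_t) (P : porderType d) :=
  Choice.on (extgroup P).

Definition ext_fun {d : Order.disp_t} {P : porderType d} (g : extgroup P) :
  P -> P := sval g.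
Coercion ext_fun : extgroup >-> Funclass.

Section ExtGroup.
Context {d : Order.disp_t} {P : porderType d}.
Implicit Types (f g h : extgroup P).

Lemma ext_inj f g : (forall F, f F = g F) -> f = g.
Proof. by move=> fg; apply: val_inj; apply/funext. Qed.

Lemma ext_bij g : bijective g.
Proof. by case/asboolP: (svalP g) => -[]. Qed.

Lemma ext_one_subproof : `[< is_ext (@id P) >].
Proof. by apply/asboolP; left; split => //; exists id. Qed.

Lemma ext_mul_subproof g h : `[< is_ext (h \o g) >].
Proof.
have bhg : bijective (h \o g) by apply: bij_comp; exact: ext_bij.
apply/asboolP.
case/asboolP: (svalP g) => -[_ mg]; case/asboolP: (svalP h) => -[_ mh].
- by left; split=> // F G /=; rewrite mh mg.
- by right; split=> // F G /=; rewrite mh mg.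
- by right; split=> // F G /=; rewrite mh mg.
- by left; split=> // F G /=; rewrite mh mg.
Qed.

Lemma ext_inv_exists g :
  {g' : P -> P | [/\ cancel g g', cancel g' g & is_ext g']}.
Proof.
apply: cid; have [g' gK g'K] : bijective (sval g) := ext_bij g.
exists g'; split=> //.
have bg' : bijective g' by exists g.
case/asboolP: (svalP g) => -[_ mg].
- by left; split=> // F G; rewrite -mg !g'K.
- by right; split=> // F G; rewrite -mg !g'K.
Qed.

Lemma ext_inv_subproof g : `[< is_ext (sval (ext_inv_exists g)) >].
Proof. by apply/asboolP; case: (ext_inv_exists g) => g' []. Qed.

(* Maps act on the right: g * h is g followed by h. *)
Definition ext_one : extgroup P := exist _ id ext_one_subproof.
Definition ext_mul g h : extgroup P := exist _ (h \o g) (ext_mul_subproof g h).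
Definition ext_inv g : extgroup P :=
  exist _ (sval (ext_inv_exists g)) (ext_inv_subproof g).

Lemma ext_mulA : associative ext_mul.
Proof. by move=> f g h; apply: ext_inj. Qed.
Lemma ext_mul1 : left_id ext_one ext_mul.
Proof. by move=> g; apply: ext_inj. Qed.
Lemma ext_mulr1 : right_id ext_one ext_mul.
Proof. by move=> g; apply: ext_inj. Qed.
Lemma ext_mulV : left_inverse ext_one ext_inv ext_mul.
Proof.
move=> g; apply: ext_inj => F /=; rewrite /ext_fun /=.
by case: (ext_inv_exists g) => g' [? g'K ?] /=; exact: g'K.
Qed.
Lemma ext_mulrV : right_inverse ext_one ext_inv ext_mul.
Proof.
move=> g; apply: ext_inj => F /=; rewrite /ext_fun /=.
by case: (ext_inv_exists g) => g' [gK ? ?] /=; exact: gK.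
Qed.

End ExtGroup.

#[warning="-redundant-canonical-projection"]
HB.instance Definition _ (d : Order.disp_t) (P : porderType d) :=
  isGroup.Build (extgroup P)
    ext_mulA ext_mul1 ext_mulr1 ext_mulV ext_mulrV.

Definition autgroup {d : Order.disp_t} (P : porderType d) : set (extgroup P) :=
  [set g | is_automorphism g].
Arguments autgroup {d} P _.

Section Groups.
Local Open Scope group_scope.

Definition generated {G : groupType} (A : set G) : set G :=
  smallest [set H : set G | group_closed [in H]] A.

Definition group_isomorphic {G G' : groupType} (H : set G) (K : set G') : Prop :=
  exists f : G -> G', {in H &, {morph f : x y / x * y}} /\ set_bij H K f.

(* x has order m; m = 0 encodes infinite order. *)
Definition has_order {G : groupType} (x : G) (m : nat) : Prop :=
  forall k : nat, x ^+ k = 1 <-> (m %| k)%N.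

End Groups.

Local Open Scope ring_scope.

(* adjacent rk i A B : the flags A and B differ in exactly one face, of
   rank i. *)
Definition adjacent {d : Order.disp_t} {P : porderType d} (rk : P -> int)
    (i : int) (A B : set P) : Prop :=
  [/\ is_flag A, is_flag B, A <> B &
      forall F, rk F != i -> A F <-> B F].

Definition strongly_flag_connected {d : Order.disp_t} {P : porderType d}
    (rk : P -> int) : Prop :=
  forall A B : set P, is_flag A -> is_flag B ->
  exists (k : nat) (s : nat -> set P),
    [/\ s 0%N = A, s k = B,
        forall j, (j < k)%N -> exists i, adjacent rk i (s j) (s j.+1) &
        forall j, (j <= k)%N -> A `&` B `<=` s j].

Structure polytope (n : nat) := Polytope {
  pdisp : Order.disp_t;
  face :> tbPOrderType pdisp;
  rank : face -> int;
  rank_mono : {homo rank : F G / (F < G)%O >-> F < G};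
  rank_range : range rank = [set k : int | -1 <= k <= n%:Z];
  rank_bottom : rank (\bot)%O = -1;
  rank_top : rank (\top)%O = n%:Z;
  flag_card : forall A : set face, is_flag A -> (A #= `I_n.+2)%card;
  flag_connected : strongly_flag_connected rank;
  diamond : forall (F G : face) (j : int), (F <= G)%O ->
    rank F = j - 1 -> rank G = j + 1 ->
    ([set H | rank H = j /\ (F <= H <= G)%O] #= `I_2)%card }.

Section Polytopes.
Context {n : nat} {P : polytope n}.
Implicit Types (A : set P) (s : nat -> extgroup P).

(* The i-adjacent flag of A. *)
Definition adj_flag A (i : nat) : set P :=
  xget A [set B | adjacent (@rank n P) i%:Z A B].

Definition section (F G : P) : set P := [set H | (F <= H <= G)%O].

Definition consecutive (i : nat) (F G H H' : P) : Prop :=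
  H <> H' /\ exists K, [/\ section F G K, rank K = i%:Z - 1,
                           (K <= H)%O & (K <= H')%O].

(* g permutes the i-faces of section F G in a single (possibly infinite)
   cycle, each i-face being mapped to a consecutive one. *)
Definition cyclically_permutes (g : P -> P) (i : nat) (F G : P) : Prop :=
  let S := [set H | section F G H /\ rank H = i%:Z] in
  (forall H, S H -> S (g H) /\ consecutive i F G H (g H)) /\
  (forall H H', S H -> S H' ->
     exists k, iter k g H = H' \/ iter k g H' = H).

(* s 1, ..., s (n - 1) are the distinguished generators with respect to the
   base flag A; the other values of s are irrelevant. *)
Definition distinguished A s : Prop :=
  is_flag A /\
  forall i : nat, (0 < i < n)%N ->
    [/\ is_automorphism (s i),
        forall F, A F -> rank F != i%:Z - 1 -> rank F != i%:Z -> s i F = F,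
        forall F G, A F -> A G -> rank F = i%:Z - 2 -> rank G = i%:Z + 1 ->
          cyclically_permutes (s i) i F G &
        s i @` A = adj_flag (adj_flag A i) i.-1].

(* t is the list [:: p_1; ...; p_(n-1)], with 0 standing for infinity. *)
Definition has_type s (t : seq nat) : Prop :=
  size t = n.-1 /\
  forall i, (i < n.-1)%N -> has_order (s i.+1) (nth 0%N t i).

End Polytopes.

Section Chirality.
Context {n : nat} (P : polytope n).

Definition same_orbit (A B : set P) : Prop :=
  exists2 g, autgroup P g & g @` A = B.

Definition regular : Prop :=
  forall A B : set P, is_flag A -> is_flag B -> same_orbit A B.

Definition chiral : Prop :=
  [/\ (3 <= n)%N, ~ regular &
      exists (A : set P) (s : nat -> extgroup P), distinguished A s].

Definition self_dual : Prop := exists f : P -> P, is_duality f.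

(* For chiral P there are just two flag orbits, so `the other orbit' is any
   orbit different from that of A. *)
Definition improperly_self_dual : Prop :=
  self_dual /\
  forall f : P -> P, is_duality f ->
    forall A : set P, is_flag A -> ~ same_orbit A (f @` A).

End Chirality.

(* The chiral 3-polytope M is of type {a, b | h}. *)
Definition has_hole_type (M : polytope 3) (a b h : nat) : Prop :=
  exists (A : set M) (s : nat -> extgroup M),
    [/\ distinguished A s, has_type s [:: a; b] &
        has_order (s 1%N * (s 2%N)^-1)%g h].

(* Main.v *)
(* Let M be the set of pairs (A, B) of incident faces of P with A of rank 0 or 1
   and B of rank 2 or 3, ordered by (A, B) <= (C, D) iff A <= C and D <= B, with
   a least and a greatest element added. Its vertices are the pairs (F_0, F_3),
   its edges the pairs (F_0, F_2) and (F_1, F_3), its faces the pairs (F_1, F_2).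
   A flag of M is a flag of P together with a choice between its two edges, so M
   inherits polytopality from P. Automorphisms of P act on M; so do dualities,
   which exchange the two components and hence the two kinds of edges. As every
   automorphism of M preserves or exchanges the two kinds of edges throughout, it
   acts on the flags of P either respecting adjacency or reversing its ranks, and
   therefore comes from an automorphism or a duality of P: Aut(M) is the extended
   group of P. In particular M is not regular, since P is not.

   Reading images of the base flag, kappa_1 and kappa_2 are dualities with
   Phi kappa_1 = Phi^0 and Phi kappa_2 = Phi^1; so kappa_1^2 is an involution,
   kappa_2^2 = sigma_2^-1 and kappa_1 kappa_2^-1 = sigma_3^-1, and kappa_1, kappa_2
   act on M as distinguished generators. The four flags adjacent to Phi are its
   images under kappa_1, kappa_2 and their inverses, so Lambda is transitive on
   flags; improper self-duality makes the extended group act freely on flags, and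
   Lambda is everything. *)

Require Import Defs.
From HB Require Import structures.
From mathcomp Require Import all_boot all_order all_algebra zify.
From mathcomp Require Import boolp classical_sets functions cardinality.

Set Implicit Arguments.
Unset Strict Implicit.
Unset Printing Implicit Defensive.

Import Order.TTheory GRing.Theory Num.Theory.
Local Open Scope classical_set_scope.
Local Open Scope ring_scope.

(** Gives names to the two faces that the diamond condition only counts. *)
Lemma card_eq2P (T : choiceType) (S : set T) :
  (S #= `I_2)%card <-> exists x y, x <> y /\ S = [set x; y].
Proof.
split=> [/card_set_bijP[f [fS finj fsurj]]|[x [y [xy ->]]]].
  have [x Sx fx] : (f @` S) 0%N by exact: fsurj.
  have [y Sy fy] : (f @` S) 1%N by exact: fsurj.
  exists x, y; split=> [xy|]; first by move: fy; rewrite -xy fx.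
  apply/seteqP; split=> [z Sz|z [->|->] //].
  have := fS _ Sz; rewrite /mkset => fz.
  by case fzE: (f z) fz => [|[|k]] // _; [left|right];
     apply: finj; rewrite ?inE // fzE.
have -> : [set x; y] = (fun i => if i == 0%N then x else y) @` `I_2.
  apply/seteqP; split=> [z [->|->]|z [[|i] _ <-]]; [|  |by left|by right].
    by exists 0%N.
  by exists 1%N.
apply: inj_card_eq.
move=> [|[|i]] [|[|j]]; rewrite !inE //= => _ _.
by move/esym.
Qed.

(** * Flags *)

Section Flags.
Context {d : Order.disp_t} {P : porderType d}.
Implicit Types (A B C : set P).

Lemma flag_chain A : is_flag A -> total_on A (fun F G : P => (F <= G)%O).
Proof. by case. Qed.

Lemma flag_eq A B : is_flag A -> is_flag B -> A `<=` B -> A = B.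
Proof. by move=> [_ maxA] [cB _] AB; rewrite (maxA B). Qed.

Lemma flag_extend C : total_on C (fun F G : P => (F <= G)%O) ->
  exists A, is_flag A /\ C `<=` A.
Proof.
move=> chC.
(* Asking that [X] together with [C] be a chain, rather than [X] alone, makes the empty union in
   Zorn's lemma covered by [C] being a chain. *)
pose Q (X : set P) := total_on (X `|` C) (fun F G : P => (F <= G)%O).
have [Fs FsQ Fst|A [QA maxA]] := @Zorn_bigcup _ Q.
  move=> F G [[X FX XF]|CF] [[Y FY YG]|CG].
  - case: (Fst _ _ FX FY) => XY; last by apply: (FsQ _ FX); left=> //; exact: XY.
    by apply: (FsQ _ FY); left=> //; exact: XY.
  - by apply: (FsQ _ FX); [left|right].
  - by apply: (FsQ _ FY); [right|left].
  - exact: chC.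
exists (A `|` C); split; last by move=> F; right.
split=> // B chB ACB.
have AB : A `<=` B by move=> F AF; apply: ACB; left.
have QB : Q B by rewrite /Q (_ : B `|` C = B) //; apply: setUidl => F CF; apply: ACB; right.
have [BA|nBA] := pselect (B `<=` A).
  by apply/seteqP; split=> // F /BA; left.
by case: (maxA B) => //; split.
Qed.

End Flags.

(** * Ranks and adjacency in the flags of a polytope *)

Section FlagTheory.
Context {n : nat} {P : polytope n}.
Notation rk := (@rank n P).
Implicit Types (A B C : set P) (F G H : P) (i j k : int).

Lemma rank_bounds F : -1 <= rk F <= n%:Z.
Proof.
have : range rk (rk F) by exists F.
by rewrite rank_range.
Qed.

Lemma rank_le F G : (F <= G)%O -> rk F <= rk G.
Proof. by rewrite le_eqVlt => /predU1P[->//|/rank_mono/ltW]. Qed.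

Lemma rank_le_eq F G : (F <= G)%O -> rk F = rk G -> F = G.
Proof.
by rewrite le_eqVlt => /predU1P[->//|/rank_mono + e]; rewrite e ltxx.
Qed.

Lemma flag_rank_inj A F G : is_flag A -> A F -> A G -> rk F = rk G -> F = G.
Proof.
move=> /flag_chain chA AF AG e.
by case: (chA F G) => // /rank_le_eq; [apply|move=> ->].
Qed.

Lemma flag_rank_le A F G : is_flag A -> A F -> A G -> rk F <= rk G -> (F <= G)%O.
Proof.
move=> fA AF AG FG; case: (flag_chain fA AF AG) => // GF.
by rewrite (flag_rank_inj fA AF AG) //; apply/le_anti; rewrite FG rank_le.
Qed.

(** Pigeonhole: a flag has n + 2 faces of pairwise distinct ranks, and only n + 2 ranks are
    available. *)
Lemma flag_rank_ex A k : is_flag A -> -1 <= k <= n%:Z ->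
  exists2 F, A F & rk F = k.
Proof.
move=> fA kn; have /card_set_bijP[f [fS finj fsurj]] := flag_card fA.
have /choice[h hP] (i : 'I_n.+2) : exists F, A F /\ f F = i.
  by have [F AF fF] : (f @` A) i by [apply: fsurj => /=]; exists F.
(* Ranks start at -1, hence the shift by one. *)
pose r (i : 'I_n.+2) : 'I_n.+2 := inord (absz (rk (h i) + 1)).
have r_inj : injective r.
  move=> i j /(congr1 val); rewrite /= !inordK; first last.
  - by have := rank_bounds (h i); lia.
  - by have := rank_bounds (h j); lia.
  move=> e; apply/val_inj; rewrite /= -(hP i).2 -(hP j).2.
  congr f; apply: (flag_rank_inj fA (hP i).1 (hP j).1).
  by have := rank_bounds (h i); have := rank_bounds (h j); lia.
have [r' _ rK] := injF_bij r_inj.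
pose i : 'I_n.+2 := inord (absz (k + 1)).
have [j rj] : exists j : 'I_n.+2, r j = i by exists (r' i).
exists (h j); first by case: (hP j).
have := congr1 val rj; have bj := rank_bounds (h j).
by rewrite /= !inordK; lia.
Qed.

(** In a larger chain every face is comparable with a face of [A] of its own rank, hence equal to
    it. *)
Lemma flag_of_ranks A : total_on A (fun F G => (F <= G)%O) ->
  (forall k, -1 <= k <= n%:Z -> exists2 F, A F & rk F = k) -> is_flag A.
Proof.
move=> chA rA; split=> // B chB AB; apply/seteqP; split=> // F BF.
have [G AG rG] := rA _ (rank_bounds F).
suff -> : F = G by [].
case: (chB F G) => // [|FG|GF]; first exact: AB.
  exact: rank_le_eq.
by apply/esym/rank_le_eq.
Qed.

Lemma flag_bottom A : is_flag A -> A \bot%O.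
Proof.
move=> fA; have [|F AF rF] := @flag_rank_ex A (-1) fA; first by lia.
suff -> : (\bot%O : P) = F by [].
by apply: rank_le_eq; rewrite ?le0x // rank_bottom.
Qed.

Lemma flag_top A : is_flag A -> A \top%O.
Proof.
move=> fA; have [|F AF rF] := @flag_rank_ex A n%:Z fA; first by lia.
suff -> : (\top%O : P) = F by [].
by apply/esym/rank_le_eq; rewrite ?lex1 // rank_top.
Qed.

Lemma rank_bottom_eq F : rk F = -1 -> F = \bot%O.
Proof. by move=> e; apply/esym/rank_le_eq; rewrite ?le0x // rank_bottom. Qed.

Lemma rank_top_eq F : rk F = n%:Z -> F = \top%O.
Proof. by move=> e; apply/rank_le_eq; rewrite ?lex1 // rank_top. Qed.

Lemma adjacent_sym i A B : adjacent rk i A B -> adjacent rk i B A.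
Proof.
by move=> [fA fB AB e]; split=> //; [exact/nesym|move=> F /e[]; split].
Qed.

Lemma adjacent_rank i A B F : adjacent rk i A B -> A F -> B F -> rk F != i.
Proof.
move=> [fA fB AB e] AF BF; apply/eqP => rF; apply: AB.
apply: flag_eq => // G AG; have [rG|/e[h _]] := eqVneq (rk G) i; last exact: h.
by rewrite (flag_rank_inj fA AG AF) // rG rF.
Qed.

Lemma adjacent_range i A B : adjacent rk i A B -> 0 <= i < n%:Z.
Proof.
move=> aAB; have [fA fB AB _] := aAB.
apply: contrapT => ni; apply: AB; apply: flag_eq => // F AF.
have [rF|rF] := eqVneq (rk F) i; last by case: aAB => _ _ _ /(_ _ rF)[h _]; exact: h.
have := rank_bounds F; have [e _|e] := eqVneq (rk F) (-1).
  by rewrite (rank_bottom_eq e); exact: flag_bottom.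
move=> bF; rewrite (@rank_top_eq F); first exact: flag_top.
by lia.
Qed.

(** By the diamond condition the new [i]-face is the only alternative to the old one between its
    neighbours, so it depends on the faces of ranks [i - 1], [i] and [i + 1] alone. *)
Lemma adjacent_local i A B C D :
  adjacent rk i A B -> adjacent rk i C D ->
  (forall F, i - 1 <= rk F <= i + 1 -> A F -> C F) ->
  forall F, rk F = i -> B F -> D F.
Proof.
move=> aAB aCD AC X rX BX; have rg := adjacent_range aAB.
have [fA fB _ AB] := aAB; have [fC fD _ CD] := aCD.
have [|F AF rF] := @flag_rank_ex A (i - 1) fA; first by lia.
have [|G AG rG] := @flag_rank_ex A (i + 1) fA; first by lia.
have [|a Aa ra] := @flag_rank_ex A i fA; first by lia.
have [|b Db rb] := @flag_rank_ex D i fD; first by lia.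
have BF : B F by apply/AB => //; lia.
have BG : B G by apply/AB => //; lia.
have [CF CG Ca] : [/\ C F, C G & C a] by split; apply: AC => //; lia.
have DF : D F by apply/CD => //; lia.
have DG : D G by apply/CD => //; lia.
have FG : (F <= G)%O by apply: (flag_rank_le fA) => //; lia.
have aX : a <> X by move=> e; have := adjacent_rank aAB Aa; rewrite e rX eqxx => /(_ BX).
have ab : a <> b by move=> e; have := adjacent_rank aCD Ca; rewrite e rb eqxx => /(_ Db).
have /card_eq2P[x [y [_ S]]] := diamond FG rF rG.
have inS H E : is_flag E -> E F -> E G -> E H -> rk H = i -> H = x \/ H = y.
  move=> fE EF EG EH rH; suff : [set H | rk H = i /\ (F <= H <= G)%O] H by rewrite S.
  by split=> //; rewrite !(flag_rank_le fE) //; lia.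
have := inS a A fA AF AG Aa ra; have := inS X B fB BF BG BX rX.
have := inS b D fD DF DG Db rb.
by move=> [] eb [] eX [] ea; subst => //; case: aX || case: ab.
Qed.

Lemma adjacent_uniq i A B C : adjacent rk i A B -> adjacent rk i A C -> B = C.
Proof.
move=> aAB aAC; have [_ fB _ AB] := aAB; have [_ fC _ AC] := aAC.
apply: flag_eq => // F BF; have [rF|rF] := eqVneq (rk F) i; last by apply/AC/AB.
exact: (adjacent_local aAB aAC).
Qed.

Lemma adjacent_ex i A : is_flag A -> 0 <= i < n%:Z -> exists B, adjacent rk i A B.
Proof.
move=> fA rg.
have [|F AF rF] := @flag_rank_ex A (i - 1) fA; first by lia.
have [|G AG rG] := @flag_rank_ex A (i + 1) fA; first by lia.
have [|a Aa ra] := @flag_rank_ex A i fA; first by lia.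
have FG : (F <= G)%O by apply: (flag_rank_le fA) => //; lia.
have /card_eq2P[x [y [xy S]]] := diamond FG rF rG.
have [b [ba rb /andP[Fb bG]]] : exists b, [/\ b <> a, rk b = i & (F <= b <= G)%O].
  have [Sx Sy] : [set H | rk H = i /\ (F <= H <= G)%O] x /\
                 [set H | rk H = i /\ (F <= H <= G)%O] y.
    by rewrite S; split; [left|right].
  have [e|xa] := pselect (x = a); last by exists x; case: Sx.
  by exists y; case: Sy; split=> //; rewrite -e; exact/nesym.
(* The flag [A] with its [i]-face [a] exchanged for the other face [b] of the diamond. *)
pose B := [set X | (A X /\ rk X != i) \/ X = b].
have cb X : A X -> rk X != i -> (X <= b)%O \/ (b <= X)%O.
  move=> AX rX; have [lt|ge] := ltP (rk X) i.
    by left; apply: le_trans Fb; apply: (flag_rank_le fA) => //; lia.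
  by right; apply: le_trans bG _; apply: (flag_rank_le fA) => //; lia.
have fB : is_flag B.
  apply: flag_of_ranks => [X Y [[AX rX]|->] [[AY rY]|->]|k kn].
  - exact: (flag_chain fA).
  - exact: cb.
  - by case: (cb Y AY rY) => ?; [right|left].
  - by left.
  have [->|ki] := eqVneq k i; first by exists b => //; right.
  by have [X AX rX] := flag_rank_ex fA kn; exists X => //; left; rewrite rX.
exists B; split=> //.
  move=> AB; have : B a by rewrite -AB.
  by case=> [[_]|/esym//]; rewrite ra eqxx.
move=> X rX; split=> [AX|[[]//|e]]; first by left.
by move: rX; rewrite e rb eqxx.
Qed.

Lemma adj_flagP A (i : nat) : is_flag A -> (i < n)%N ->
  adjacent rk i%:Z A (adj_flag A i).
Proof. by move=> fA ilt; apply: xgetPex; apply: adjacent_ex => //; lia. Qed.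

Lemma adj_flag_eq A B (i : nat) : adjacent rk i%:Z A B -> adj_flag A i = B.
Proof.
move=> aAB; apply: (adjacent_uniq _ aAB); apply: adj_flagP; first by case: aAB.
by have := adjacent_range aAB; lia.
Qed.

Lemma adj_flag_is_flag A (i : nat) : is_flag A -> (i < n)%N -> is_flag (adj_flag A i).
Proof. by move=> fA /(adj_flagP fA)[]. Qed.

Lemma adj_flagK A (i : nat) : is_flag A -> (i < n)%N ->
  adj_flag (adj_flag A i) i = A.
Proof. by move=> fA ilt; apply/adj_flag_eq/adjacent_sym/adj_flagP. Qed.

Lemma adj_flag_mem A (i : nat) F : is_flag A -> (i < n)%N -> rk F != i%:Z ->
  adj_flag A i F <-> A F.
Proof.
by move=> fA ilt rF; case: (adj_flagP fA ilt) => _ _ _ /(_ _ rF)[]; split.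
Qed.

(** Changing the [j]-face leaves the faces of ranks [i - 1] to [i + 1] alone, so by [adjacent_local]
    the [i]-step chooses the same new face before and after it. *)
Lemma adj_flagC A (i j : nat) : is_flag A -> (i.+1 < j)%N -> (j < n)%N ->
  adj_flag (adj_flag A i) j = adj_flag (adj_flag A j) i.
Proof.
move=> fA ij jn; have iltn : (i < n)%N by lia.
have aB := adj_flagP fA iltn; have aD := adj_flagP fA jn.
have fD := adj_flag_is_flag fA jn; have aE := adj_flagP fD iltn.
set B := adj_flag A i in aB *; set D := adj_flag A j in aD fD aE *.
set E := adj_flag D i in aE *.
have fB : is_flag B by case: aB.
have fE : is_flag E by case: aE.
have BE F : rk F = i%:Z -> B F <-> E F.
  have AD G : i%:Z - 1 <= rk G <= i%:Z + 1 -> A G <-> D G.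
    by move=> rG; case: aD => _ _ _; apply; lia.
  move=> rF; split; first by apply: (adjacent_local aB aE) rF => G rG /(AD _ rG).
  by apply: (adjacent_local aE aB) rF => G rG /(AD _ rG).
apply: adj_flag_eq; split=> //.
  move=> e; have [|F AF rF] := @flag_rank_ex A j%:Z fA; first by lia.
  have BF : B F by apply/(adj_flag_mem fA) => //; lia.
  have : E F by rewrite -e.
  move/(adj_flag_mem fD iltn) => /(_ ltac:(lia)) DF.
  by have := adjacent_rank aD AF DF; rewrite rF eqxx.
move=> F rF; have [/BE//|rFi] := eqVneq (rk F) i%:Z.
have := adj_flag_mem fA iltn rFi; have := adj_flag_mem fD iltn rFi.
by rewrite -/B -/E; case: aD => _ _ _ /(_ _ rF); tauto.
Qed.

(** Strong flag-connectedness as an induction principle. The faces common to [A] and [B] stay in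
    every flag on the way, which allows arguments restricted to the flags through given faces. *)
Lemma flag_ind (Q : set P -> Prop) A B : is_flag A -> is_flag B -> Q A ->
  (forall i C D, adjacent rk i C D -> A `&` B `<=` C -> A `&` B `<=` D ->
     Q C -> Q D) -> Q B.
Proof.
move=> fA fB QA IH; have [k [s [s0 sk adj sub]]] := flag_connected fA fB.
suff Qs m : (m <= k)%N -> Q (s m) by rewrite -sk; exact: Qs.
elim: m => [|m IHm] mk; first by rewrite s0.
have [i a] := adj _ mk.
by apply: (IH i _ _ a); [apply: sub..|apply: IHm]; rewrite // ltnW.
Qed.

Lemma flag_mem F : exists A, is_flag A /\ A F.
Proof.
have [|A [fA FA]] := @flag_extend _ P [set F].
  by move=> X Y -> ->; left.
by exists A; split=> //; exact: FA.
Qed.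

Lemma flag_mem2 F G : (F <= G)%O -> exists A, [/\ is_flag A, A F & A G].
Proof.
move=> FG; have [|A [fA FA]] := @flag_extend _ P [set F; G].
  by move=> X Y [->|->] [->|->]; [left|left|right|left].
by exists A; split=> //; apply: FA; [left|right].
Qed.

End FlagTheory.

(** * Automorphisms and dualities *)

(** For bijective [f], a relation by integer powers of [f], written without inverses as in
    [cyclically_permutes]. *)
Definition orbit_rel (T : Type) (f : T -> T) (x y : T) :=
  exists k, iter k f x = y \/ iter k f y = x.

Lemma orbit_rel_sym (T : Type) (f : T -> T) x y : orbit_rel f x y -> orbit_rel f y x.
Proof. by move=> [k [h|h]]; exists k; [right|left]. Qed.

(** Injectivity cancels common iterates when [x] and [z] both run into [y]. *)
Lemma orbit_rel_trans (T : Type) (f : T -> T) x y z : injective f ->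
  orbit_rel f x y -> orbit_rel f y z -> orbit_rel f x z.
Proof.
move=> injf.
have iter_inj m : injective (iter m f).
  by elim: m => // m IH u v /= /injf/IH.
have common u v w a c : iter a f u = w -> iter c f v = w -> orbit_rel f u v.
  move=> eu ev; have [le|/ltnW le] := leqP c a.
    by exists (a - c)%N; left; apply: (@iter_inj c); rewrite -iterD subnKC ?eu.
  by exists (c - a)%N; right; apply: (@iter_inj a); rewrite -iterD subnKC ?ev.
move=> [a [xy|yx]] [c [yz|zy]].
- by exists (c + a)%N; left; rewrite iterD xy.
- exact: common xy zy.
- have [le|/ltnW le] := leqP c a.
    exists (a - c)%N; right; rewrite -yz -iterD subnK //.
  by exists (c - a)%N; left; rewrite -yx -iterD subnK.
- by exists (a + c)%N; right; rewrite iterD zy.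
Qed.

Section ExtTheory.
Context {d : Order.disp_t} {P : porderType d}.
Implicit Types (g h : extgroup P) (F G : P) (A : set P).

Definition isdual g : bool := `[< is_duality g >].

Lemma ext_mulE g h F : ext_fun (g * h)%g F = h (g F).
Proof. by []. Qed.

Lemma extK g F : ext_fun g^-1%g (g F) = F.
Proof. by rewrite -ext_mulE mulgV. Qed.

Lemma extVK g F : g (ext_fun g^-1%g F) = F.
Proof. by rewrite -ext_mulE mulVg. Qed.

Lemma ext_injective g : injective g.
Proof. exact: (can_inj (extK g)). Qed.

Lemma ext_le g F G : (g F <= g G)%O = if isdual g then (G <= F)%O else (F <= G)%O.
Proof.
rewrite /isdual; case: asboolP => [[_ ->]//|nd].
by case/asboolP: (svalP g) => [[_ ->]|].
Qed.

Lemma isdual_aut g : ~~ isdual g -> is_automorphism g.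
Proof. by case/asboolP: (svalP g) => // dg /negP[]; apply/asboolP. Qed.

Lemma image_ext_mul g h A : ext_fun (g * h)%g @` A = h @` (g @` A).
Proof. by rewrite image_comp. Qed.

Lemma image_ext1 A : ext_fun (1 : extgroup P)%g @` A = A.
Proof. exact: image_id. Qed.

Lemma image_extK g A : ext_fun g^-1%g @` (g @` A) = A.
Proof. by rewrite -image_ext_mul mulgV image_ext1. Qed.

Lemma image_extVK g A : g @` (ext_fun g^-1%g @` A) = A.
Proof. by rewrite -image_ext_mul mulVg image_ext1. Qed.

Lemma image_extE g A F : (g @` A) (g F) <-> A F.
Proof. by split=> [[G AG /ext_injective <-//]|AF]; exists F. Qed.

End ExtTheory.

(** * Action of automorphisms and dualities on ranks and flags *)

Section ExtPolytope.
Context {n : nat} {P : polytope n}.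
Notation rk := (@rank n P).
Implicit Types (g h : extgroup P) (F G : P) (A B : set P) (i j k : int).

(** The effect on ranks of a duality ([b] true) or an automorphism ([b] false). *)
Definition flip (b : bool) k : int := if b then n%:Z - 1 - k else k.

Lemma flipK b : involutive (flip b).
Proof. by case: b => k; rewrite /flip; lia. Qed.

Lemma flip_bounds b k : (-1 <= flip b k <= n%:Z) = (-1 <= k <= n%:Z).
Proof. by case: b; rewrite /flip; lia. Qed.

Lemma rank_pred F : rk F != -1 -> exists2 G, (G < F)%O & rk G = rk F - 1.
Proof.
move=> rF; have [A [fA AF]] := flag_mem F.
have bF := rank_bounds F.
have [|G AG rG] := @flag_rank_ex _ _ A (rk F - 1) fA; first by lia.
exists G => //; rewrite lt_neqAle (flag_rank_le fA) //; last by lia.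
by rewrite andbT; apply/eqP => e; move: rG; rewrite e; lia.
Qed.

Lemma rank_succ F : rk F != n%:Z -> exists2 G, (F < G)%O & rk G = rk F + 1.
Proof.
move=> rF; have [A [fA AF]] := flag_mem F.
have bF := rank_bounds F.
have [|G AG rG] := @flag_rank_ex _ _ A (rk F + 1) fA; first by lia.
exists G => //; rewrite lt_neqAle (flag_rank_le fA) //; last by lia.
by rewrite andbT; apply/eqP => e; move: rG; rewrite e; lia.
Qed.

(** Induction on the rank, passing to a smaller face one rank lower. Applied to an automorphism and
    to its inverse, it shows that ranks are preserved. *)
Lemma monotone_rank_ge (f : P -> P) : {homo f : F G / (F < G)%O} ->
  forall F, rk F <= rk (f F).
Proof.
move=> mf F; have [m] := ubnP (absz (rk F + 1)).
elim: m F => // m IH F Fm; have bF := rank_bounds F.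
have := rank_bounds (f F); have [->|rF] := eqVneq (rk F) (-1); first by lia.
have [G GF rG] := rank_pred rF; have := rank_mono (mf _ _ GF).
have := rank_bounds G; have : (absz (rk G + 1)%R < m)%N by lia.
by move/IH; lia.
Qed.

(** The upper bound climbs from the least face, the lower bound descends from the greatest. *)
Lemma antitone_rank (f : P -> P) : {homo f : F G / (F < G)%O >-> (G < F)%O} ->
  forall F, rk (f F) = n%:Z - 1 - rk F.
Proof.
move=> mf F; suff [lb ub] : rk (f F) <= n%:Z - 1 - rk F /\
    n%:Z - 1 - rk F <= rk (f F) by lia.
split.
  have [m] := ubnP (absz (rk F + 1)).
  elim: m F => // m IH F Fm; have bF := rank_bounds F.
  have := rank_bounds (f F); have [->|rF] := eqVneq (rk F) (-1); first by lia.
  have [G GF rG] := rank_pred rF; have := rank_mono (mf _ _ GF).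
  have := rank_bounds G; have : (absz (rk G + 1)%R < m)%N by lia.
  by move/IH; lia.
have [m] := ubnP (absz (n%:Z - rk F)).
elim: m F => // m IH F Fm; have bF := rank_bounds F.
have := rank_bounds (f F); have [->|rF] := eqVneq (rk F) n%:Z; first by lia.
have [G GF rG] := rank_succ rF; have := rank_mono (mf _ _ GF).
have := rank_bounds G; have : (absz (n%:Z - rk G)%R < m)%N by lia.
by move/IH; lia.
Qed.

Lemma bottom_neq_top : (\bot%O : P) <> \top%O.
Proof. by move/(congr1 rk); rewrite rank_bottom rank_top; lia. Qed.

(** A map both preserving and reversing the order would identify the least and greatest faces. *)
Lemma aut_isdual g : is_automorphism g -> isdual g = false.
Proof.
move=> [_ ag]; apply/asboolP => -[_ dg]; apply: bottom_neq_top.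
apply: (@ext_injective _ _ g); apply/le_anti.
by apply/andP; split; [rewrite ag le0x|rewrite dg le0x].
Qed.

Lemma isdualP g : reflect (is_duality g) (isdual g).
Proof. exact: asboolP. Qed.

Lemma aut_isdualP g : autgroup P g <-> ~~ isdual g.
Proof. by split=> [/aut_isdual->|/isdual_aut]. Qed.

Lemma isdual1 : isdual (1 : extgroup P)%g = false.
Proof. by apply: aut_isdual; split=> //; exists id. Qed.

Lemma isdual_eq g b : (forall F G, (g F <= g G)%O = if b then (G <= F)%O else (F <= G)%O) ->
  isdual g = b.
Proof.
case: b => mg; last by apply: aut_isdual; split=> //; exact: ext_bij.
by apply/asboolP; split=> //; exact: ext_bij.
Qed.

Lemma isdualM g h : isdual (g * h)%g = isdual g (+) isdual h.
Proof.
apply: isdual_eq => F G; rewrite !ext_mulE !ext_le.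
by case: (isdual g); case: (isdual h).
Qed.

Lemma isdualV g : isdual g^-1%g = isdual g.
Proof.
have := isdualM g g^-1%g; rewrite mulgV isdual1.
by case: (isdual g); case: (isdual _).
Qed.

Lemma ext_lt g F G : (g F < g G)%O = if isdual g then (G < F)%O else (F < G)%O.
Proof.
rewrite !lt_neqAle ext_le (inj_eq (@ext_injective _ _ g)).
by case: ifP => //; rewrite eq_sym.
Qed.

Lemma rank_ext g F : rk (g F) = flip (isdual g) (rk F).
Proof.
have := ext_lt g; have := ext_lt g^-1%g; rewrite isdualV /flip.
case: (isdual g) => gV gE.
  by apply: antitone_rank => X Y; rewrite gE.
have h1 : {homo g : F G / (F < G)%O} by move=> X Y; rewrite gE.
have h2 : {homo (ext_fun g^-1%g) : F G / (F < G)%O} by move=> X Y; rewrite gV.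
have := monotone_rank_ge h1 F; have := monotone_rank_ge h2 (g F).
by rewrite extK; lia.
Qed.

Lemma ext_is_flag g A : is_flag A -> is_flag (g @` A).
Proof.
move=> fA; apply: flag_of_ranks => [_ _ [F AF <-] [G AG <-]|k].
  rewrite !ext_le; have := flag_chain fA AF AG.
  by case: isdual => [[]|//]; [right|left].
rewrite -(flip_bounds (isdual g)) => /(flag_rank_ex fA)[F AF rF].
by exists (g F); [exists F|rewrite rank_ext rF flipK].
Qed.

Lemma ext_adjacent g i A B : adjacent rk i A B ->
  adjacent rk (flip (isdual g) i) (g @` A) (g @` B).
Proof.
move=> [fA fB AB e]; split; [exact: ext_is_flag..| |].
  by move/(congr1 (fun X => ext_fun g^-1%g @` X)); rewrite !image_extK.
move=> F; rewrite -(extVK g F) rank_ext (inj_eq (inv_inj (flipK _))).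
by move=> /e h; rewrite !image_extE.
Qed.

Lemma adj_flag_ext g A (m : nat) : is_flag A -> (m < n)%N ->
  adj_flag (g @` A) (if isdual g then n.-1 - m else m)%N = g @` adj_flag A m.
Proof.
move=> fA mn; apply: adj_flag_eq.
have := ext_adjacent g (adj_flagP fA mn); congr adjacent.
by rewrite /flip; case: isdual => //; lia.
Qed.

(** Agreement on a flag spreads to its adjacent flags, since these are unique, then by connectedness
    to all flags, and so to all faces. *)
Lemma ext_eq g h A : is_flag A -> isdual g = isdual h -> g @` A = h @` A -> g = h.
Proof.
move=> fA gh ghA; apply: ext_inj => F; have [B [fB BF]] := flag_mem F.
have ghB : g @` B = h @` B.
  apply: (@flag_ind _ _ (fun B => g @` B = h @` B) A) => // i C D aCD _ _ gC.
  apply: (adjacent_uniq (ext_adjacent g aCD)).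
  by rewrite gC gh; exact: ext_adjacent.
apply: (flag_rank_inj (ext_is_flag g fB)); last by rewrite !rank_ext gh.
  by exists F.
by rewrite ghB; exists F.
Qed.

(* A map of flags respecting adjacency is well defined on faces: any two flags
   through [F] are connected by flags through [F]. *)
Lemma flag_map_face (b : bool) (phi : set P -> set P) :
  (forall A, is_flag A -> is_flag (phi A)) ->
  (forall i A B, adjacent rk i A B -> adjacent rk (flip b i) (phi A) (phi B)) ->
  exists f : P -> P, forall A F, is_flag A -> A F ->
    phi A (f F) /\ rk (f F) = flip b (rk F).
Proof.
move=> fphi aphi.
have /choice[f fP] (F : P) : exists G, forall A, is_flag A -> A F ->
    phi A G /\ rk G = flip b (rk F).
  have [A [fA AF]] := flag_mem F.
  have [|G AG rG] := @flag_rank_ex _ _ (phi A) (flip b (rk F)) (fphi _ fA).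
    by rewrite flip_bounds rank_bounds.
  exists G => B fB BF; split=> //.
  apply: (@flag_ind _ _ (fun B => phi B G) A) => // i C D aCD CAB DAB CG.
  have iF : rk F != i by apply: (adjacent_rank aCD); [apply: CAB|apply: DAB].
  have [_ _ _ /(_ G) h] := aphi _ _ _ aCD; apply/h => //.
  by rewrite rG (inj_eq (inv_inj (flipK _))).
by exists f => A F fA AF; apply: fP.
Qed.

(** Incident faces lie in a common flag, so the face map given by [flag_map_face] is monotone or
    antitone according to [b]; the face map of [psi] is its inverse. *)
Lemma flag_map_ext (b : bool) (phi psi : set P -> set P) :
  (forall A, is_flag A -> is_flag (phi A)) ->
  (forall A, is_flag A -> is_flag (psi A)) ->
  (forall A, is_flag A -> psi (phi A) = A) ->
  (forall A, is_flag A -> phi (psi A) = A) ->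
  (forall i A B, adjacent rk i A B -> adjacent rk (flip b i) (phi A) (phi B)) ->
  (forall i A B, adjacent rk i A B -> adjacent rk (flip b i) (psi A) (psi B)) ->
  exists g, isdual g = b /\ forall A, is_flag A -> g @` A = phi A.
Proof.
move=> fphi fpsi phiK psiK aphi apsi.
have [f fP] := flag_map_face fphi aphi.
have [f' f'P] := flag_map_face fpsi apsi.
have mono (h : P -> P) (chi : set P -> set P) :
    (forall A, is_flag A -> is_flag (chi A)) ->
    (forall A F, is_flag A -> A F -> chi A (h F) /\ rk (h F) = flip b (rk F)) ->
    forall F G, (F <= G)%O -> if b then (h G <= h F)%O else (h F <= h G)%O.
  move=> fchi hP F G FG; have [A [fA AF AG]] := flag_mem2 FG.
  have [cF rF] := hP _ _ fA AF; have [cG rG] := hP _ _ fA AG.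
  have := rank_le FG; case: (b) rF rG => rF rG; rewrite /flip in rF rG => FGr.
    by apply: (flag_rank_le (fchi _ fA)) => //; lia.
  by apply: (flag_rank_le (fchi _ fA)) => //; lia.
have can (h h' : P -> P) (chi chi' : set P -> set P) :
    (forall A, is_flag A -> is_flag (chi A)) ->
    (forall A, is_flag A -> chi' (chi A) = A) ->
    (forall A F, is_flag A -> A F -> chi A (h F) /\ rk (h F) = flip b (rk F)) ->
    (forall A F, is_flag A -> A F -> chi' A (h' F) /\ rk (h' F) = flip b (rk F)) ->
    cancel h h'.
  move=> fchi chiK hP h'P F; have [A [fA AF]] := flag_mem F.
  have [cF rF] := hP _ _ fA AF.
  have [cF' rF'] := h'P _ _ (fchi _ fA) cF.
  rewrite chiK // in cF'; apply: (flag_rank_inj fA) => //.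
  by rewrite rF' rF flipK.
have fK := can f f' phi psi fphi phiK fP f'P.
have f'K := can f' f psi phi fpsi psiK f'P fP.
have fle F G : (f F <= f G)%O = if b then (G <= F)%O else (F <= G)%O.
  have monof := mono f phi fphi fP; have monof' := mono f' psi fpsi f'P.
  apply/idP/idP; first by move/monof'; rewrite !fK.
  by case: (b) monof => {}mono /mono.
have fext : `[< is_ext f >].
  apply/asboolP; have bf : bijective f by exists f'.
  by case: (b) fle => fle; [right|left].
exists (exist _ f fext); split; first exact: isdual_eq.
move=> A fA; apply: flag_eq; [exact: ext_is_flag|exact: fphi|].
by move=> _ [F AF <-]; case: (fP _ _ fA AF).
Qed.

(* Alternating the steps [i] and [i - 1] from [A] meets exactly the flags
   [A g^k] and their [(i - 1)]-adjacent flags, and the latter have the same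
   [i]-faces as the former. *)
Lemma distinguished_cyclic A g (m : nat) : is_flag A -> (0 < m < n)%N ->
  ~~ isdual g -> g @` A = adj_flag (adj_flag A m) m.-1 ->
  forall F G, A F -> A G -> rk F = m%:Z - 2 -> rk G = m%:Z + 1 ->
    cyclically_permutes g m F G.
Proof.
move=> fA mn ag gA F G AF AG rF rG.
have mltn : (m < n)%N by lia.
have m1n : (m.-1 < n)%N by lia.
have m1E : m.-1%:Z = m%:Z - 1 by lia.
set B := adj_flag A m in gA; have aAB : adjacent rk m%:Z A B by exact: adj_flagP.
have fB : is_flag B by case: aAB.
have aBC := adj_flagP fB m1n; rewrite -gA m1E in aBC.
have rkg H : rk (g H) = rk H by rewrite rank_ext (negbTE ag).
have fix_g H : A H -> rk H != m%:Z - 1 -> rk H != m%:Z -> g H = H.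
  move=> AH r1 r0; apply: (flag_rank_inj (ext_is_flag g fA)).
  - by exists H.
  - case: aAB => _ _ _ /(_ _ r0)[+ _] => /(_ AH) BH.
    by case: aBC => _ _ _ /(_ _ r1)[+ _]; apply.
  - exact: rkg.
have gF : g F = F by apply: fix_g => //; lia.
have gG : g G = G by apply: fix_g => //; lia.
have [|a Aa ra] := @flag_rank_ex _ _ A m%:Z fA; first by lia.
have [|c Ac rc] := @flag_rank_ex _ _ A (m%:Z - 1) fA; first by lia.
have Bga : B (g a).
  case: aBC => _ _ _ /(_ (g a)) h; apply/h; last by exists a.
  by rewrite rkg; lia.
have ga_neq : g a <> a.
  by move=> e; have := adjacent_rank aAB Aa; rewrite ra eqxx -{1}e => /(_ Bga).
have ca : (c <= a)%O by apply: (flag_rank_le fA) => //; lia.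
have Fc : (F <= c)%O by apply: (flag_rank_le fA) => //; lia.
have cga : (c <= g a)%O.
  apply: (flag_rank_le fB) => //; last by rewrite rkg; lia.
  by case: aAB => _ _ _ /(_ c) h; apply/h => //; lia.
(* Taking the two steps in the opposite order moves backwards along the cycle. *)
have adjV : adj_flag (adj_flag A m.-1) m = ext_fun g^-1%g @` A.
  apply: (can_inj (image_extK g)); rewrite image_extVK.
  have /(_ _ m) := @adj_flag_ext g; rewrite (negbTE ag) => adjm.
  have /(_ _ m.-1) := @adj_flag_ext g; rewrite (negbTE ag) => adjm1.
  rewrite -adjm // -?adjm1 //; last exact: adj_flag_is_flag.
  by rewrite gA adj_flagK // /B adj_flagK.
pose S := [set H | section F G H /\ rk H = m%:Z].
(* The [h] constructed here is built up as a power of [g]; only the properties used below are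
   carried along. *)
have SP H : S H -> exists h, [/\ (h * g = g * h)%g, orbit_rel g a (h a),
     h F = F, ~~ isdual h & H = h a].
  move=> [/andP[FH HG] rH].
  (* A chain: a flag [D] containing it passes through [H] and can differ from [A] in ranks [m - 1]
     and [m] only. *)
  pose X := [set Y | (A Y /\ rk Y != m%:Z - 1 /\ rk Y != m%:Z) \/ Y = H].
  have cX Y : A Y -> rk Y != m%:Z - 1 -> rk Y != m%:Z -> (Y <= H)%O \/ (H <= Y)%O.
    move=> AY r1 r0; have [lt|ge] := ltP (rk Y) m%:Z.
      by left; apply: le_trans FH; apply: (flag_rank_le fA) => //; lia.
    by right; apply: le_trans HG _; apply: (flag_rank_le fA) => //; lia.
  have [|D [fD XD]] := @flag_extend _ P X.
    move=> Y Z [[AY [r1 r0]]|->] [[AZ [s1 s0]]|->].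
    - exact: (flag_chain fA).
    - exact: cX.
    - by case: (cX Z AZ s1 s0) => ?; [right|left].
    - by left.
  have DH : D H by apply: XD; right.
  pose Q E := exists h, [/\ (h * g = g * h)%g, orbit_rel g a (h a),
     h F = F, ~~ isdual h & E = h @` A \/ E = adj_flag (h @` A) m.-1].
  have adjh h (l : nat) : ~~ isdual h -> (l < n)%N -> forall E, is_flag E ->
      adj_flag (h @` E) l = h @` adj_flag E l.
    move=> ah ln E fE; have := @adj_flag_ext h E l fE ln.
    by rewrite (negbTE ah).
  have [h [hg Rh hF ah DE]] : Q D.
    apply: (@flag_ind _ _ Q A) => //.
      exists 1%g; split; rewrite ?mul1g ?mulg1 ?isdual1 //.
        by exists 0%N; left.
      by left; rewrite image_ext1.
    move=> j E E' aEE ADE ADE' [h [hg Rh hF ah hE]].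
    (* A face of any other rank is common to [A] and [D], hence never changes on the path. *)
    have jm : j = m%:Z \/ j = m.-1%:Z.
      apply: contrapT => nj; have rgj := adjacent_range aEE.
      have [|Y AY rY] := @flag_rank_ex _ _ A j fA; first by lia.
      have DY : D Y by apply: XD; left; split=> //; split; lia.
      have := adjacent_rank aEE (ADE _ (conj AY DY)) (ADE' _ (conj AY DY)).
      by rewrite rY eqxx.
    have fhA := ext_is_flag h fA.
    have E'E (l : nat) : j = l%:Z -> E' = adj_flag E l.
      by move=> jl; rewrite jl in aEE; apply/esym/adj_flag_eq.
    (* An [m]-step from the image of [A] under [h] leads to the [(m - 1)]-neighbour of its image
       under [g * h]; from the neighbour of the former it leads to the image under [g^-1 * h]. An
       [(m - 1)]-step keeps [h]. *)
    case: jm => jm; case: hE => eE.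
    - exists (g * h)%g; split; rewrite ?isdualM ?(negbTE ag) //.
      + by rewrite -mulgA hg.
      + apply: (orbit_rel_trans (@ext_injective _ _ g) Rh).
        by exists 1%N; left; rewrite /= -!ext_mulE hg.
      + by rewrite ext_mulE gF.
      right; rewrite (E'E _ jm) eE adjh // -/B image_ext_mul gA adjh //
        ?adj_flagK //; exact: adj_flag_is_flag.
    - exists (g^-1 * h)%g; split; rewrite ?isdualM ?isdualV ?(negbTE ag) //.
      + by rewrite -mulgA hg mulgA mulVg mul1g mulgA mulgV mul1g.
      + apply: (orbit_rel_trans (@ext_injective _ _ g) Rh).
        exists 1%N; right; rewrite [LHS](_ : _ = ext_fun (g^-1 * h * g)%g a) // -mulgA hg.
        by rewrite mulgA mulVg mul1g.
      + by rewrite ext_mulE -{1}gF extK.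
      left; rewrite (E'E _ jm) eE adjh // adjh ?adjV ?image_ext_mul //.
      exact: adj_flag_is_flag.
    - by exists h; split=> //; right; rewrite (E'E _ jm) eE.
    - by exists h; split=> //; left; rewrite (E'E _ jm) eE adj_flagK.
  exists h; split=> //.
  have : (h @` A) H.
    case: DE => eD; first by rewrite -eD.
    apply/(adj_flag_mem (ext_is_flag h fA) m1n); last by rewrite -eD.
    by rewrite rH; lia.
  case=> Y AY hY; rewrite -hY; congr (h _); apply: (flag_rank_inj fA) => //.
  by move: rH; rewrite -hY rank_ext (negbTE ah) ra.
split=> [H SH|H H' SH SH'].
  have [h [hg _ hF ah HE]] := SP _ SH.
  have [/andP[FH HG] rH] := SH.
  have leh := ext_le h; rewrite (negbTE ah) in leh.
  have leg := ext_le g; rewrite (negbTE ag) in leg.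
  split.
    split; last by rewrite rkg.
    by apply/andP; rewrite -{1}gF -gG !leg.
  have gHE : g H = h (g a) by rewrite HE -!ext_mulE hg.
  split.
    by rewrite gHE HE => /ext_injective /esym.
  (* The [(m - 1)]-face [c] of [A] lies below both [a] and [g a], so its image lies below both [H]
     and [g H]. *)
  exists (h c); split.
  - apply/andP; split; first by rewrite -{1}hF leh.
    by apply: le_trans HG; rewrite HE leh.
  - by rewrite rank_ext (negbTE ah).
  - by rewrite HE leh.
  - by rewrite gHE leh.
have [h [_ Rh _ _ HE]] := SP _ SH; have [h' [_ Rh' _ _ HE']] := SP _ SH'.
apply: (orbit_rel_trans (@ext_injective _ _ g) _ (_ : orbit_rel g a H')).
  by apply: orbit_rel_sym; rewrite HE.
by rewrite HE'.
Qed.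

(** The image of the base flag is enough: faces of the other ranks are fixed because [A] and its
    image share them, and [distinguished_cyclic] gives the cyclic action. *)
Lemma distinguished_intro A (s : nat -> extgroup P) : is_flag A ->
  (forall m : nat, (0 < m < n)%N -> ~~ isdual (s m) /\
     s m @` A = adj_flag (adj_flag A m) m.-1) ->
  distinguished A s.
Proof.
move=> fA sP; split=> // m mn; have [am sA] := sP m mn; split=> //.
- exact: isdual_aut.
- have mltn : (m < n)%N by lia.
  have m1n : (m.-1 < n)%N by lia.
  move=> F AF r1 r0; apply: (flag_rank_inj (ext_is_flag (s m) fA)).
  + by exists F.
  + rewrite sA; apply/(adj_flag_mem (adj_flag_is_flag fA mltn) m1n).
      by rewrite (_ : m.-1%:Z = m%:Z - 1) //; lia.
    exact/(adj_flag_mem fA mltn).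
  + by rewrite rank_ext (negbTE am).
- exact: distinguished_cyclic.
Qed.

End ExtPolytope.

(** * The 3-polytope M *)

Section FlagPath.
Context {d : Order.disp_t} {P : porderType d} (rk : P -> int).
Implicit Types (A B C X : set P).

(** The set [X] is a parameter, rather than the intersection of the two ends, so that it stays fixed
    while a path is extended. *)
Inductive flag_path X A : set P -> Prop :=
| FlagPath0 : X `<=` A -> flag_path X A A
| FlagPathS i B C : flag_path X A B -> adjacent rk i B C -> X `<=` C ->
    flag_path X A C.

Lemma flag_path_connected :
  (forall A B, is_flag A -> is_flag B -> flag_path (A `&` B) A B) ->
  strongly_flag_connected rk.
Proof.
move=> conn A B fA fB; have := conn _ _ fA fB.
move: (A `&` B) => X; elim=> [XA|i C D _ [k [s [s0 sk adj sub]]] aCD XD].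
  by exists 0%N, (fun=> A); split.
exists k.+1, (fun j => if (j <= k)%N then s j else D); split=> //.
- by rewrite ltnn.
- move=> j; rewrite ltnS leq_eqVlt => /predU1P[->|jk].
    by exists i; rewrite eqxx ltnn sk.
  by rewrite jk orbT; exact: adj.
- by move=> j _; case: ifP => [/sub h|_]; [exact: h|exact: XD].
Qed.

End FlagPath.

(* The least and greatest faces of M are encoded as (F_-1, F_4) and (F_4, F_-1),
   which lets the order of M be defined uniformly. *)
Definition medial_valid (P : polytope 4) (x : P * P) : bool :=
  [|| (rank x.1 == -1) && (rank x.2 == 4), (rank x.1 == 4) && (rank x.2 == -1)
    | [&& 0 <= rank x.1 <= 1, 2 <= rank x.2 <= 3 & (x.1 <= x.2)%O]].

Definition medial_face (P : polytope 4) : Type := {x : P * P | medial_valid x}.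

#[warning="-redundant-canonical-projection"]
HB.instance Definition _ (P : polytope 4) := Choice.on (medial_face P).

Section Medial.
Context {P : polytope 4}.
Notation rk := (@rank 4 P).
Local Notation M := (medial_face P).
Implicit Types (x y z : M) (F G : P) (Psi : set P) (b : bool) (i j k : int).

Definition lo x : P := (sval x).1.
Definition hi x : P := (sval x).2.

Lemma medial_inj x y : lo x = lo y -> hi x = hi y -> x = y.
Proof.
rewrite /lo /hi => e1 e2; apply: val_inj => /=.
by rewrite (surjective_pairing (sval x)) e1 e2 -surjective_pairing.
Qed.

(** Replacing F_0 by F_1, or F_3 by F_2, raises the rank by one; the encodings of the least and
    greatest faces do not fit this formula. *)
Definition medial_rank x : int :=
  if rk (lo x) == -1 then -1 else if rk (lo x) == 4 then 3
  else rk (lo x) + 3 - rk (hi x).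

Lemma medial_rankP x :
  [\/ [/\ rk (lo x) = -1, rk (hi x) = 4 & medial_rank x = -1],
      [/\ rk (lo x) = 4, rk (hi x) = -1 & medial_rank x = 3] |
      [/\ 0 <= rk (lo x) <= 1, 2 <= rk (hi x) <= 3 &
          medial_rank x = rk (lo x) + 3 - rk (hi x)]].
Proof.
rewrite /medial_rank; have := svalP x.
rewrite /medial_valid -/(lo x) -/(hi x) => /or3P[/andP[/eqP-> /eqP->]|/andP[/eqP-> /eqP->]|].
- by constructor 1.
- by constructor 2.
- by case/and3P=> bl bh _; constructor 3; split=> //; do 2?case: eqP; lia.
Qed.

Lemma medial_lo_hi x : 0 <= medial_rank x <= 2 -> (lo x <= hi x)%O.
Proof.
move=> rx; have := svalP x; rewrite /medial_valid -/(lo x) -/(hi x).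
have := medial_rankP x => rxP.
by case/or3P => [/andP[/eqP e1 /eqP e2]|/andP[/eqP e1 /eqP e2]|/and3P[//]];
   case: rxP => -[]; lia.
Qed.

Definition medial_le x y := (lo x <= lo y)%O && (hi y <= hi x)%O.

Lemma medial_le_refl : reflexive medial_le.
Proof. by move=> x; rewrite /medial_le !lexx. Qed.

Lemma medial_le_anti : antisymmetric medial_le.
Proof.
move=> x y /andP[/andP[l1 h1] /andP[l2 h2]].
by apply: medial_inj; apply/le_anti; rewrite ?l1 ?l2 ?h1 ?h2.
Qed.

Lemma medial_le_trans : transitive medial_le.
Proof.
move=> y x z /andP[l1 h1] /andP[l2 h2].
by rewrite /medial_le (le_trans l1 l2) (le_trans h2 h1).
Qed.

Lemma medial_bottom_valid : medial_valid (\bot%O : P, \top%O : P).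
Proof. by rewrite /medial_valid /= rank_bottom rank_top. Qed.

Lemma medial_top_valid : medial_valid (\top%O : P, \bot%O : P).
Proof. by rewrite /medial_valid /= rank_bottom rank_top. Qed.

Definition medial_bottom : M := exist _ (\bot%O, \top%O) medial_bottom_valid.
Definition medial_top : M := exist _ (\top%O, \bot%O) medial_top_valid.

Lemma medial_le0x x : medial_le medial_bottom x.
Proof. by rewrite /medial_le le0x lex1. Qed.

Lemma medial_lex1 x : medial_le x medial_top.
Proof. by rewrite /medial_le le0x lex1. Qed.

End Medial.

Fact medial_display : Order.disp_t. Proof. exact: Order.Disp tt tt. Qed.

HB.instance Definition _ (P : polytope 4) :=
  Order.Le_isPOrder.Build medial_display (medial_face P)
    medial_le_refl medial_le_anti medial_le_trans.
HB.instance Definition _ (P : polytope 4) :=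
  Order.hasBottom.Build medial_display (medial_face P) medial_le0x.
HB.instance Definition _ (P : polytope 4) :=
  Order.hasTop.Build medial_display (medial_face P) medial_lex1.

(** * The polytope axioms for M *)

Section MedialPolytope.
Context {P : polytope 4}.
Notation rk := (@rank 4 P).
Local Notation M := (medial_face P).
Local Notation mrk := (@medial_rank P).
Implicit Types (x y z : M) (F G : P) (Psi : set P) (b : bool) (i j k : int).

Lemma medial_leE x y : (x <= y)%O = (lo x <= lo y)%O && (hi y <= hi x)%O.
Proof. by []. Qed.

Lemma medial_rank_mono : {homo mrk : x y / (x < y)%O >-> x < y}.
Proof.
move=> x y xy; have /andP[neq le] : (x != y) && (x <= y)%O by rewrite -lt_neqAle.
move: le; rewrite medial_leE => /andP[l h].
have := rank_le l; have := rank_le h => rh rl.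
rewrite lt_neqAle; apply/andP; split; last first.
  by case: (medial_rankP x) => -[]; case: (medial_rankP y) => -[]; lia.
apply/eqP => e; move/eqP: neq; apply; apply: medial_inj.
  by apply: (rank_le_eq l);
    case: (medial_rankP x) => -[]; case: (medial_rankP y) => -[]; lia.
by apply/esym/(rank_le_eq h);
  case: (medial_rankP x) => -[]; case: (medial_rankP y) => -[]; lia.
Qed.

Lemma medial_rank_bottom : mrk \bot%O = -1.
Proof. by rewrite /medial_rank [lo _]/(\bot%O : P) rank_bottom eqxx. Qed.

Lemma medial_rank_top : mrk \top%O = 3.
Proof. by rewrite /medial_rank [lo _]/(\top%O : P) rank_top. Qed.

(* Junk value: the least face, when (F, G) does not encode a face of M. *)
Definition mface F G : M := insubd (medial_bottom : M) (F, G).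

Lemma mfaceE F G : 0 <= rk F <= 1 -> 2 <= rk G <= 3 -> (F <= G)%O ->
  [/\ lo (mface F G) = F, hi (mface F G) = G &
      mrk (mface F G) = rk F + 3 - rk G].
Proof.
move=> bF bG FG; have vFG : medial_valid (F, G) by rewrite /medial_valid /= bF bG FG !orbT.
have e : sval (mface F G) = (F, G) by rewrite /mface -[sval _]/(val _) insubdK.
have lE : lo (mface F G) = F by rewrite /lo e.
have hE : hi (mface F G) = G by rewrite /hi e.
split=> //; case: (medial_rankP (mface F G)); rewrite lE hE => -[]; lia.
Qed.

(* The [b]-flag over [Psi = (F_0, .., F_3)] has the edge [(F_0, F_2)] if [b]
   holds, and [(F_1, F_3)] otherwise. *)
Definition mflag Psi b : set M :=
  [set x | [/\ Psi (lo x), Psi (hi x) & mrk x = 1 -> (rk (lo x) == 0) = b]].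

Lemma mflag_mface Psi b F G : is_flag Psi -> Psi F -> Psi G ->
  0 <= rk F <= 1 -> 2 <= rk G <= 3 -> (rk F + 3 - rk G = 1 -> (rk F == 0) = b) ->
  [/\ mflag Psi b (mface F G), lo (mface F G) = F, hi (mface F G) = G &
      mrk (mface F G) = rk F + 3 - rk G].
Proof.
move=> fP PF PG bF bG e; have FG : (F <= G)%O by apply: (flag_rank_le fP) => //; lia.
by have [lE hE rE] := mfaceE bF bG FG; split=> //; split; rewrite ?lE ?hE // rE.
Qed.

Lemma mflag_chain Psi b : is_flag Psi -> total_on (mflag Psi b) (fun x y => (x <= y)%O).
Proof.
move=> fP x y [Plx Phx ex] [Ply Phy ey]; rewrite !medial_leE.
have le F G : Psi F -> Psi G -> rk F <= rk G -> (F <= G)%O by exact: flag_rank_le.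
have : (rk (lo x) <= rk (lo y) /\ rk (hi y) <= rk (hi x)) \/
       (rk (lo y) <= rk (lo x) /\ rk (hi x) <= rk (hi y)).
  case: (medial_rankP x) ex => -[l1 h1 r1]; case: (medial_rankP y) ey => -[l2 h2 r2];
  rewrite r1 r2 => ex ey; try by [left; lia|right; lia].
  (* Over one flag, the only incomparable pair consists of the edges (F_0, F_2) and (F_1, F_3), and
     [b] excludes one of them. *)
  have [?|?] := leP (rk (lo x)) (rk (lo y)); have [?|?] := leP (rk (hi x)) (rk (hi y)).
  - have [?|?] := eqVneq (rk (hi x)) (rk (hi y)); first by left; lia.
    have [?|?] := eqVneq (rk (lo x)) (rk (lo y)); first by right; lia.
    by move: (ex ltac:(lia)) (ey ltac:(lia)); case: eqP; case: eqP; lia.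
  - by left; lia.
  - by right; lia.
  - by move: (ex ltac:(lia)) (ey ltac:(lia)); case: eqP; case: eqP; lia.
by case=> -[h1 h2]; [left|right]; rewrite !le.
Qed.

(** The vertex gives back F_0 and F_3, the 2-face gives F_1 and F_2, and the edge gives the bit. *)
Lemma mflag_sub_eq Psi Psi' b b' : is_flag Psi -> is_flag Psi' ->
  mflag Psi b `<=` mflag Psi' b' -> Psi = Psi' /\ b = b'.
Proof.
move=> fP fP' sub.
have subF F G : Psi F -> Psi G -> 0 <= rk F <= 1 -> 2 <= rk G <= 3 ->
    (rk F + 3 - rk G = 1 -> (rk F == 0) = b) ->
    [/\ Psi' F, Psi' G & rk F + 3 - rk G = 1 -> (rk F == 0) = b'].
  move=> PF PG bF bG e; have [+ lE hE rE] := mflag_mface fP PF PG bF bG e.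
  by move/sub => [+ +]; rewrite lE hE rE.
have [F0 P0 r0] : exists2 F, Psi F & rk F = 0 by exact: flag_rank_ex.
have [F1 P1 r1] : exists2 F, Psi F & rk F = 1 by exact: flag_rank_ex.
have [F2 P2 r2] : exists2 F, Psi F & rk F = 2 by exact: flag_rank_ex.
have [F3 P3 r3] : exists2 F, Psi F & rk F = 3 by exact: flag_rank_ex.
have [|||P0' P3' _] := subF _ _ P0 P3; try lia.
have [|||P1' P2' _] := subF _ _ P1 P2; try lia.
split; last first.
  case: (b) subF => subF.
    have [||| _ _ e] := subF _ _ P0 P2; try by rewrite ?r0 ?r2.
    by rewrite -e; rewrite r0 ?r2.
  have [||| _ _ e] := subF _ _ P1 P3; try by rewrite ?r1 ?r3.
  by rewrite -e; rewrite r1 ?r3.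
apply: flag_eq => // F PF; have bF := rank_bounds F.
have inj G : Psi G -> rk F = rk G -> Psi' G -> Psi' F.
  by move=> PG e P'G; rewrite (flag_rank_inj fP PF PG e).
have : [\/ rk F = -1, rk F = 0 | [\/ rk F = 1, rk F = 2 | rk F = 3 \/ rk F = 4]].
  case: (ltP (rk F) 0) => ?; first by constructor 1; lia.
  case: (ltP (rk F) 1) => ?; first by constructor 2; lia.
  constructor 3; case: (ltP (rk F) 2) => ?; first by constructor 1; lia.
  case: (ltP (rk F) 3) => ?; first by constructor 2; lia.
  by constructor 3; lia.
case=> [rF|rF|[rF|rF|[rF|rF]]].
- by rewrite (rank_bottom_eq rF); exact: flag_bottom.
- by apply: (inj F0); rewrite ?r0.
- by apply: (inj F1); rewrite ?r1.
- by apply: (inj F2); rewrite ?r2.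
- by apply: (inj F3); rewrite ?r3.
- by rewrite (rank_top_eq rF); exact: flag_top.
Qed.

(** The components of the members of [C] form a chain in P, which extends to a flag. The bit is read
    off from the edge in [C], of which there is at most one, and is false if there is none. *)
Lemma mflag_of_chain (C : set M) : total_on C (fun x y => (x <= y)%O) ->
  exists Psi b, is_flag Psi /\ C `<=` mflag Psi b.
Proof.
move=> chC.
have lohi x : (lo x <= hi x)%O \/ (lo x = \top%O /\ hi x = \bot%O).
  have := @medial_lo_hi _ x; case: (medial_rankP x) => -[r1 r2 ->].
  - by move=> _; left; rewrite (rank_bottom_eq r1) le0x.
  - by move=> _; right; rewrite (rank_top_eq r1) (rank_bottom_eq r2).
  - by move=> h; left; apply: h; lia.
pose CP := [set F | exists2 x, C x & F = lo x \/ F = hi x].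
have chCP : total_on CP (fun F G => (F <= G)%O).
  have key x y F G : (x <= y)%O -> F = lo x \/ F = hi x -> G = lo y \/ G = hi y ->
      (F <= G)%O \/ (G <= F)%O.
    rewrite medial_leE => /andP[l h] [->|->] [->|->].
    - by left.
    - case: (lohi y) => [lh|[_ ->]]; first by left; exact: le_trans lh.
      by right; exact: le0x.
    - case: (lohi y) => [lh|[-> _]]; last by left; exact: lex1.
      by right; apply: le_trans lh h.
    - by right.
  move=> F G [x Cx Fx] [y Cy Gy]; case: (chC _ _ Cx Cy) => xy; first exact: key Fx Gy.
  by case: (key _ _ _ _ xy Gy Fx) => ?; [right|left].
have [Psi [fP CPsi]] := flag_extend chCP.
exists Psi, `[< exists2 x, C x & mrk x = 1 /\ rk (lo x) = 0 >]; split=> // x Cx.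
split; [by apply: CPsi; exists x => //; left|by apply: CPsi; exists x => //; right|].
move=> rx; apply/eqP/asboolP => [r0|[y Cy [ry r0]]]; first by exists x.
suff -> : x = y by [].
by case: (chC _ _ Cx Cy); rewrite le_eqVlt => /predU1P[->//|/medial_rank_mono];
  rewrite rx ry ltxx.
Qed.

Lemma mflag_is_flag Psi b : is_flag Psi -> is_flag (mflag Psi b).
Proof.
move=> fP; split=> [|B chB PB]; first exact: mflag_chain.
have [Psi' [b' [fP' BP']]] := mflag_of_chain chB.
have [e eb] := mflag_sub_eq fP fP' (subset_trans PB BP').
by apply/seteqP; split=> //; rewrite e eb.
Qed.

Lemma mflag_inj Psi Psi' b b' : is_flag Psi -> is_flag Psi' ->
  mflag Psi b = mflag Psi' b' -> Psi = Psi' /\ b = b'.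
Proof. by move=> fP fP' e; apply: mflag_sub_eq => //; rewrite e. Qed.

Lemma medial_flagP (A : set M) : is_flag A ->
  exists Psi b, is_flag Psi /\ A = mflag Psi b.
Proof.
move=> fA; have [Psi [b [fP AP]]] := mflag_of_chain (flag_chain fA).
by exists Psi, b; split=> //; apply: flag_eq => //; exact: mflag_is_flag.
Qed.

Lemma mflag_ranks Psi b k : is_flag Psi -> -1 <= k <= 3 ->
  exists2 x, mflag Psi b x & mrk x = k.
Proof.
move=> fP bk.
have [F0 P0 r0] : exists2 F, Psi F & rk F = 0 by exact: flag_rank_ex.
have [F1 P1 r1] : exists2 F, Psi F & rk F = 1 by exact: flag_rank_ex.
have [F2 P2 r2] : exists2 F, Psi F & rk F = 2 by exact: flag_rank_ex.
have [F3 P3 r3] : exists2 F, Psi F & rk F = 3 by exact: flag_rank_ex.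
have [k0|k0] := ltP k 0.
  exists \bot%O; last by rewrite medial_rank_bottom; lia.
  by split; [exact: flag_bottom|exact: flag_top|rewrite medial_rank_bottom].
have [k1|k1] := ltP k 1.
  have [||| Px _ _ rx] := @mflag_mface _ b _ _ fP P0 P3; try lia.
  by exists (mface F0 F3) => //; lia.
have [k2|k2] := ltP k 2.
  case: b.
    have [||| Px _ _ rx] := @mflag_mface _ true _ _ fP P0 P2; rewrite ?r0 ?r2 //.
    by exists (mface F0 F2) => //; lia.
  have [||| Px _ _ rx] := @mflag_mface _ false _ _ fP P1 P3; rewrite ?r1 ?r3 //.
  by exists (mface F1 F3) => //; lia.
have [k3|k3] := ltP k 3.
  have [||| Px _ _ rx] := @mflag_mface _ b _ _ fP P1 P2; try lia.
  by exists (mface F1 F2) => //; lia.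
exists \top%O; last by rewrite medial_rank_top; lia.
by split; [exact: flag_top|exact: flag_bottom|rewrite medial_rank_top].
Qed.

Lemma medial_rank_range : range mrk = [set k : int | -1 <= k <= 3%:Z].
Proof.
apply/seteqP; split=> [_ [x _ <-]|k bk] /=.
  by case: (medial_rankP x) => -[]; lia.
have [|Psi [fP _]] := @flag_extend _ P set0; first by [].
by have [x _ <-] := mflag_ranks true fP bk; exists x.
Qed.

Lemma medial_flag_card (A : set M) : is_flag A -> (A #= `I_5)%card.
Proof.
move=> fA; have [Psi [b [fP AE]]] := medial_flagP fA.
apply/card_set_bijP; exists (fun x => absz (mrk x + 1)); split.
- by move=> x _ /=; case: (medial_rankP x) => -[]; lia.
- move=> x y; rewrite !inE => Ax Ay e.
  have {}e : mrk x = mrk y.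
    by case: (medial_rankP x) => -[]; case: (medial_rankP y) => -[]; lia.
  by case: (flag_chain fA Ax Ay); rewrite le_eqVlt => /predU1P[->//|/medial_rank_mono];
    rewrite e ltxx.
move=> k /= kn; have [|x Px rx] := @mflag_ranks _ b (k%:Z - 1) fP; first by lia.
by exists x; rewrite ?AE // rx; lia.
Qed.

Lemma mface_lo_hi x : 0 <= mrk x <= 2 -> mface (lo x) (hi x) = x.
Proof.
move=> rx; have lh := medial_lo_hi rx; have xP := medial_rankP x.
have [||lE hE _] := mfaceE _ _ lh; try by case: xP => -[]; lia.
exact: medial_inj.
Qed.

(** Below an edge, and above one, a single component varies, within a diamond of P; between a vertex
    and a 2-face the two edges arise by mixing their components. *)
Lemma medial_diamond x y j : (x <= y)%O -> mrk x = j - 1 -> mrk y = j + 1 ->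
  ([set z | mrk z = j /\ (x <= z <= y)%O] #= `I_2)%card.
Proof.
move=> xy rx ry; have := xy; rewrite medial_leE => /andP[lxy hxy].
have rl := rank_le lxy; have rh := rank_le hxy.
(* Transports a diamond of P along a parametrization [f] by one component, which [f'] reads back. *)
have key (S : set P) (f : P -> M) (f' : M -> P) : (S #= `I_2)%card ->
    (forall F, S F -> [/\ mrk (f F) = j, (x <= f F)%O, (f F <= y)%O & f' (f F) = F]) ->
    (forall z, mrk z = j -> (x <= z)%O -> (z <= y)%O -> S (f' z) /\ z = f (f' z)) ->
    ([set z | mrk z = j /\ (x <= z <= y)%O] #= `I_2)%card.
  move=> S2 fS f'S; have -> : [set z | mrk z = j /\ (x <= z <= y)%O] = f @` S.
    apply/seteqP; split=> [z [rz /andP[xz zy]]|_ [F SF <-]].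
      by have [Sz ->] := f'S z rz xz zy; exists (f' z).
    by have [rF xF Fy _] := fS _ SF; split=> //; rewrite xF Fy.
  apply: card_eq_trans S2; apply: inj_card_eq => F G; rewrite !inE => SF SG e.
  by have [_ _ _ <-] := fS _ SF; have [_ _ _ <-] := fS _ SG; rewrite e.
have lhx := @medial_lo_hi _ x; have lhy := @medial_lo_hi _ y.
case: (medial_rankP x) => -[lx hx rxE]; case: (medial_rankP y) => -[ly hy ryE]; try lia.
- have xbot z : (x <= z)%O.
    by rewrite medial_leE (rank_bottom_eq lx) (rank_top_eq hx) le0x lex1.
  have {}lhy : (lo y <= hi y)%O by apply: lhy; lia.
  have [ly0|ly1] : rk (lo y) = 0 /\ rk (hi y) = 2 \/ rk (lo y) = 1 /\ rk (hi y) = 3 by lia.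
    apply: (key [set F | rk F = 3 /\ (hi y <= F <= \top)%O] (mface (lo y)) hi).
    + by apply: diamond; rewrite ?lex1 ?rank_top //; lia.
    + move=> F [rF /andP[yF _]]; have yyF := le_trans lhy yF.
      have [||lE hE rE] := mfaceE _ _ yyF; try lia.
      by split=> //; [lia|rewrite medial_leE lE hE lexx].
    + move=> z rz _; rewrite medial_leE => /andP[l h].
      have zP := medial_rankP z; have := rank_le l; have := rank_le h => rhz rlz.
      have <- : lo z = lo y by apply: (rank_le_eq l); case: zP => -[]; lia.
      rewrite mface_lo_hi; last by lia.
      by split=> //; split; [case: zP => -[]; lia|rewrite h lex1].
  apply: (key [set F | rk F = 0 /\ (\bot <= F <= lo y)%O] (mface^~ (hi y)) lo).
  + by apply: diamond; rewrite ?le0x ?rank_bottom //; lia.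
  + move=> F [rF /andP[_ Fy]]; have yyF := le_trans Fy lhy.
    have [||lE hE rE] := mfaceE _ _ yyF; try lia.
    by split=> //; [lia|rewrite medial_leE lE hE lexx Fy].
  + move=> z rz _; rewrite medial_leE => /andP[l h].
    have zP := medial_rankP z; have := rank_le l; have := rank_le h => rhz rlz.
    have -> : hi y = hi z by apply: (rank_le_eq h); case: zP => -[]; lia.
    rewrite mface_lo_hi; last by lia.
    by split=> //; split; [case: zP => -[]; lia|rewrite l le0x].
- have ytop z : (z <= y)%O.
    by rewrite medial_leE (rank_bottom_eq hy) (rank_top_eq ly) le0x lex1.
  have {}lhx : (lo x <= hi x)%O by apply: lhx; lia.
  have [lx0|lx1] : rk (lo x) = 0 /\ rk (hi x) = 2 \/ rk (lo x) = 1 /\ rk (hi x) = 3 by lia.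
    apply: (key [set F | rk F = 1 /\ (lo x <= F <= hi x)%O] (mface^~ (hi x)) lo).
    + by apply: diamond => //; lia.
    + move=> F [rF /andP[xF Fx]].
      have [||lE hE rE] := mfaceE _ _ Fx; try lia.
      by split=> //; [lia|rewrite medial_leE lE hE lexx xF].
    + move=> z rz + _; rewrite medial_leE => /andP[l h].
      have zP := medial_rankP z; have := rank_le l; have := rank_le h => rhz rlz.
      have e : hi z = hi x by apply: (rank_le_eq h); case: zP => -[]; lia.
      rewrite -e mface_lo_hi; last by lia.
      split=> //; split; first by case: zP => -[]; lia.
      by rewrite l medial_lo_hi //; lia.
  apply: (key [set F | rk F = 2 /\ (lo x <= F <= hi x)%O] (mface (lo x)) hi).
  + by apply: diamond => //; lia.
  + move=> F [rF /andP[xF Fx]].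
    have [||lE hE rE] := mfaceE _ _ xF; try lia.
    by split=> //; [lia|rewrite medial_leE lE hE lexx Fx].
  + move=> z rz + _; rewrite medial_leE => /andP[l h].
    have zP := medial_rankP z; have := rank_le l; have := rank_le h => rhz rlz.
    have e : lo x = lo z by apply: (rank_le_eq l); case: zP => -[]; lia.
    rewrite e mface_lo_hi; last by lia.
    split=> //; split; first by case: zP => -[]; lia.
    by rewrite h medial_lo_hi //; lia.
have {}lhy : (lo y <= hi y)%O by apply: lhy; lia.
have {}lhx : (lo x <= hi x)%O by apply: lhx; lia.
have [||l1 h1 r1] := mfaceE _ _ (le_trans lxy lhy); try lia.
have [||l2 h2 r2] := mfaceE _ _ (le_trans lhy hxy); try lia.
apply/card_eq2P; exists (mface (lo x) (hi y)), (mface (lo y) (hi x)); split.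
  by move/(congr1 (@lo P)); rewrite l1 l2 => /(congr1 rk); lia.
apply/seteqP; split=> [z [rz]|z [->|->]]; last 2 first.
- by split; [lia|rewrite !medial_leE l1 h1 !lexx lxy hxy].
- by split; [lia|rewrite !medial_leE l2 h2 !lexx lxy hxy].
rewrite !medial_leE => /andP[/andP[lxz hxz] /andP[lzy hzy]].
have zP := medial_rankP z.
have := rank_le lxz; have := rank_le hxz; have := rank_le lzy; have := rank_le hzy.
move=> ? ? ? ?.
have [rlz|rlz] := eqVneq (rk (lo z)) (rk (lo x)); [left|right].
  apply: medial_inj; rewrite ?l1 ?h1; first exact/esym/rank_le_eq.
  by apply/esym/rank_le_eq => //; case: zP => -[]; lia.
apply: medial_inj; rewrite ?l2 ?h2; apply/rank_le_eq => //; case: zP => -[]; lia.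
Qed.

(* Changing the [i]-face of a flag of P keeps the edge chosen in M only if that
   edge is [(F_0, F_2)] for odd [i] and [(F_1, F_3)] for even [i]; in M it is then
   a change of the face of rank [mstep i]. *)
Definition medge_of i : bool := (i == 1) || (i == 3).
Definition mstep i : int := if (i == 0) || (i == 3) then 0 else 2.

Lemma mflag_adjacent i Psi Psi' : adjacent rk i Psi Psi' ->
  adjacent mrk (mstep i) (mflag Psi (medge_of i)) (mflag Psi' (medge_of i)).
Proof.
move=> aPP; have bi := adjacent_range aPP; have [fP fP' neq PP'] := aPP.
split; [exact: mflag_is_flag..|by move/mflag_inj => [] // /neq|].
move=> x rx.
(* Membership of [x] can change only through a component of rank [i]; for [mrk x] other than
   [mstep i], such an [x] is an edge of the kind not chosen. *)
suff h F : F = lo x \/ F = hi x -> rk F != i \/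
    ~ (mrk x = 1 -> (rk (lo x) == 0) = medge_of i).
  have tr F : F = lo x \/ F = hi x -> (mrk x = 1 -> (rk (lo x) == 0) = medge_of i) ->
      Psi F <-> Psi' F.
    by move=> Fx e; case: (h F Fx) => // rF; exact: PP'.
  split=> -[Pl Ph e]; split=> //.
  - by apply/(tr _ _ e) => //; left.
  - by apply/(tr _ _ e) => //; right.
  - by apply/(tr _ _ e) => //; left.
  - by apply/(tr _ _ e) => //; right.
move=> Fx; have [rF|] := eqVneq (rk F) i; [right=> e|by left].
have : [\/ i = 0, i = 1 | i = 2 \/ i = 3] by case: (ltP i 1) => ?; [constructor 1|
  case: (ltP i 2) => ?; [constructor 2|constructor 3]]; lia.
move: rx e; rewrite /mstep /medge_of; have := medial_rankP x.
move=> xP + + iE; case: iE rF => [->|->|[->|->]] rF /= rx e;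
  case: xP => -[? ? ?]; case: Fx rF => ->; try lia; move=> ?;
  move: (e ltac:(lia)); case: eqP; lia.
Qed.

Lemma mflag_toggle Psi b : is_flag Psi ->
  adjacent mrk 1 (mflag Psi b) (mflag Psi (~~ b)).
Proof.
move=> fP; split; [exact: mflag_is_flag..| |].
  by move/mflag_inj => [] // _; case: b.
by move=> x rx; split=> -[Pl Ph _]; split=> // e; rewrite e in rx.
Qed.

(** A path in P lifts to M by toggling the edge to [medge_of i] before each [i]-step. The bits
    satisfying [ok] are those that keep a common edge of the two flags, if there is one. *)
Lemma medial_connected : strongly_flag_connected mrk.
Proof.
apply: flag_path_connected => A B.
move=> /medial_flagP[Psi [b [fP ->]]] /medial_flagP[Psi' [b' [fP' ->]]].
set X := _ `&` _.
pose ok c := forall x, X x -> mrk x = 1 -> (rk (lo x) == 0) = c.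
have okb : ok b by move=> x [[_ _ h] _].
have okb' : ok b' by move=> x [_ [_ _ h]].
have sub Om c : ok c -> Psi `&` Psi' `<=` Om -> X `<=` mflag Om c.
  move=> okc PO x Xx; have [[Pl Ph _] [Pl' Ph' _]] := Xx.
  by split; [exact: PO|exact: PO|exact: okc].
suff : forall c, ok c -> flag_path mrk X (mflag Psi b) (mflag Psi' c) by exact.
have tog Om c c' : is_flag Om -> Psi `&` Psi' `<=` Om -> ok c -> ok c' ->
    flag_path mrk X (mflag Psi b) (mflag Om c) ->
    flag_path mrk X (mflag Psi b) (mflag Om c').
  move=> fO PO okc okc' path; have [<-//|] := eqVneq c c'.
  move=> cc'; apply: (FlagPathS path); last exact: (sub _ _ okc' PO).
  have -> : c' = ~~ c by case: (c) (c') cc' => [] [].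
  exact: mflag_toggle.
apply: (@flag_ind _ _ (fun Om => forall c, ok c ->
  flag_path mrk X (mflag Psi b) (mflag Om c)) Psi) => //.
  move=> c okc; apply: (tog _ b) => //.
  by apply: FlagPath0 => x [].
move=> i C D aCD PC PD IH c okc; have [fC fD _ _] := aCD.
(* The components of a common edge are in both [C] and [D], so neither has rank [i], and the edge is
   of the kind that the [i]-step keeps. *)
have oki : ok (medge_of i).
  move=> x Xx rx; have [[Pl Ph _] [Pl' Ph' _]] := Xx.
  have ln := adjacent_rank aCD (PC _ (conj Pl Pl')) (PD _ (conj Pl Pl')).
  have hn := adjacent_rank aCD (PC _ (conj Ph Ph')) (PD _ (conj Ph Ph')).
  have bi := adjacent_range aCD.
  move: ln hn; rewrite /medge_of; case: (medial_rankP x) => -[? ? ?];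
    lia.
apply: (tog _ (medge_of i)) => //.
by apply: (FlagPathS (IH _ oki) (mflag_adjacent aCD)); exact: sub.
Qed.

Definition medial : polytope 3 :=
  @Polytope 3 medial_display (medial_face P) mrk medial_rank_mono medial_rank_range
    medial_rank_bottom medial_rank_top medial_flag_card medial_connected
    medial_diamond.

End MedialPolytope.
Arguments medial P : clear implicits.

(** * The automorphism group of M *)

Section MedialExt.
Context {P : polytope 4}.
Notation rk := (@rank 4 P).
Local Notation mrk := (@medial_rank P).
Local Notation flip4 := (@flip 4).
Implicit Types (g h : extgroup P) (f : extgroup (medial P)) (Psi : set P) (b : bool).

Lemma medial_ext_valid g (x : medial_face P) :
  medial_valid (if isdual g then (g (hi x), g (lo x)) else (g (lo x), g (hi x))).
Proof.
rewrite /medial_valid.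
case dg: (isdual g) => /=; rewrite !rank_ext ext_le dg /flip;
  have [[? ? _]|[? ? _]|[? ? r]] := medial_rankP x; try lia;
  by rewrite (@medial_lo_hi _ x) ?r; lia.
Qed.

Definition medial_ext_fun g (x : medial P) : medial P :=
  exist _ (if isdual g then (g (hi x), g (lo x)) else (g (lo x), g (hi x)))
    (medial_ext_valid g x).

Lemma lo_medial_ext g x :
  lo (medial_ext_fun g x) = if isdual g then g (hi x) else g (lo x).
Proof. by rewrite /lo /=; case: ifP. Qed.

Lemma hi_medial_ext g x :
  hi (medial_ext_fun g x) = if isdual g then g (lo x) else g (hi x).
Proof. by rewrite /hi /=; case: ifP. Qed.

Lemma medial_ext_funM g h x :
  medial_ext_fun (g * h)%g x = medial_ext_fun h (medial_ext_fun g x).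
Proof.
apply: medial_inj; rewrite !(lo_medial_ext, hi_medial_ext) isdualM;
  by case: (isdual g); case: (isdual h).
Qed.

Lemma medial_ext_fun1 x : medial_ext_fun 1%g x = x.
Proof. by apply: medial_inj; rewrite !(lo_medial_ext, hi_medial_ext) isdual1. Qed.

Lemma medial_ext_is_aut g : is_automorphism (medial_ext_fun g).
Proof.
split.
  exists (medial_ext_fun g^-1%g) => x; rewrite -medial_ext_funM.
    by rewrite mulgV medial_ext_fun1.
  by rewrite mulVg medial_ext_fun1.
move=> x y; rewrite !medial_leE !(lo_medial_ext, hi_medial_ext).
case: ifP => dg; rewrite !ext_le dg //; exact: andbC.
Qed.

Lemma medial_ext_is_ext g : `[< is_ext (medial_ext_fun g) >].
Proof. by apply/asboolP; left; exact: medial_ext_is_aut. Qed.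

Definition medial_ext g : extgroup (medial P) :=
  exist _ (medial_ext_fun g) (medial_ext_is_ext g).

Lemma medial_extM : {morph medial_ext : g h / (g * h)%g}.
Proof. by move=> g h; apply: ext_inj => x; exact: medial_ext_funM. Qed.

Lemma medial_ext1 : medial_ext 1%g = 1%g.
Proof. by apply: ext_inj => x; exact: medial_ext_fun1. Qed.

Lemma isdual_medial_ext g : isdual (medial_ext g) = false.
Proof. by apply: aut_isdual; exact: medial_ext_is_aut. Qed.

Lemma medial_ext_mflag g Psi b : is_flag Psi ->
  medial_ext g @` mflag Psi b = mflag (g @` Psi) (b (+) isdual g).
Proof.
move=> fP; apply: flag_eq.
- by apply: (@ext_is_flag 3 (medial P)); exact: mflag_is_flag.
- by apply: mflag_is_flag; exact: ext_is_flag.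
move=> _ [x [Pl Ph e] <-].
have rx : mrk (medial_ext g x) = mrk x.
  by have := @rank_ext 3 (medial P) (medial_ext g) x; rewrite isdual_medial_ext.
split; rewrite ?rx.
- by rewrite lo_medial_ext; case: ifP => _; [exists (hi x)|exists (lo x)].
- by rewrite hi_medial_ext; case: ifP => _; [exists (lo x)|exists (hi x)].
move=> r1; rewrite -(e r1) lo_medial_ext.
case: (medial_rankP x) => -[? ? ?]; try lia.
by case: ifP => dg; rewrite rank_ext dg /flip; lia.
Qed.

Lemma medial_ext_inj : injective medial_ext.
Proof.
move=> g h e; have [|Psi [fP _]] := @flag_extend _ P set0; first by [].
have := medial_ext_mflag g true fP; rewrite e medial_ext_mflag //.
case/mflag_inj; try exact: ext_is_flag.
by move=> gh dgh; apply: (ext_eq fP) => //; case: (isdual g) (isdual h) dgh => [] [].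
Qed.

Lemma medial_aut_toggle f Psi Psi' b b' : isdual f = false ->
  is_flag Psi -> is_flag Psi' -> f @` mflag Psi b = mflag Psi' b' ->
  f @` mflag Psi (~~ b) = mflag Psi' (~~ b').
Proof.
move=> df fP fP' e.
have := ext_adjacent f (mflag_toggle b fP : adjacent (@rank 3 (medial P)) _ _ _).
rewrite df e => a1.
exact: (@adjacent_uniq 3 (medial P) _ _ _ _ a1 (mflag_toggle b' fP')).
Qed.

(** The bit [eps] records whether [f] exchanges the two kinds of edges. One choice of edge is
    handled by [mflag_adjacent], the other by toggling. *)
Lemma medial_aut_step f (eps : bool) i Psi Om Psi' : isdual f = false ->
  adjacent rk i Psi Om -> is_flag Psi' ->
  (forall b, f @` mflag Psi b = mflag Psi' (b (+) eps)) ->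
  exists2 Om', adjacent rk (flip4 eps i) Psi' Om' &
    forall b, f @` mflag Om b = mflag Om' (b (+) eps).
Proof.
move=> df aPO fP' fE; have bi := adjacent_range aPO.
have [|Om' aPO'] := @adjacent_ex _ _ (flip4 eps i) Psi' fP'.
  by rewrite /flip; case: (eps); lia.
exists Om' => //; have [_ fO _ _] := aPO; have [_ fO' _ _] := aPO'.
have := ext_adjacent f (mflag_adjacent aPO : adjacent (@rank 3 (medial P)) _ _ _).
rewrite df /= fE => a1.
(* Ranks [i] and [3 - i] give the same step in M, made over opposite edges. *)
have sE : mstep (flip4 eps i) = mstep i.
  by rewrite /mstep /flip; case: (eps) => //; do 2 case: ifP; lia.
have eE : medge_of (flip4 eps i) = medge_of i (+) eps.
  by rewrite /medge_of /flip; case: (eps); rewrite ?addbF ?addbT; lia.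
have := mflag_adjacent aPO'; rewrite sE eE => a2.
have e := @adjacent_uniq 3 (medial P) _ _ _ _ a1 a2.
move=> b; have [->//|] := eqVneq b (medge_of i).
move=> bN; have -> : b = ~~ medge_of i by case: (b) (medge_of i) bN => [] [].
by rewrite addNb; exact: medial_aut_toggle.
Qed.

(** The bit [eps] is read off on one flag and carried to all others by connectedness. *)
Lemma medial_aut_flags f : isdual f = false ->
  exists (eps : bool) (phi : set P -> set P),
    [/\ forall Psi, is_flag Psi -> is_flag (phi Psi),
        forall Psi b, is_flag Psi -> f @` mflag Psi b = mflag (phi Psi) (b (+) eps) &
        forall i Psi Om, adjacent rk i Psi Om ->
          adjacent rk (flip4 eps i) (phi Psi) (phi Om)].
Proof.
move=> df; have [|Phi [fPhi _]] := @flag_extend _ P set0; first by [].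
have fim : is_flag (f @` mflag Phi true).
  by apply: (@ext_is_flag 3 (medial P)); exact: mflag_is_flag.
have [Phi1 [b1 [fPhi1 fE]]] := medial_flagP fim.
(* The edge bit [true] is sent to [b1], so it is toggled exactly when [b1] is false. *)
pose eps := ~~ b1.
have ex Psi : is_flag Psi -> exists2 Psi', is_flag Psi' &
    forall b, f @` mflag Psi b = mflag Psi' (b (+) eps).
  move=> fP; apply: (@flag_ind _ _ (fun Psi => exists2 Psi', is_flag Psi' &
    forall b, f @` mflag Psi b = mflag Psi' (b (+) eps)) Phi) => //.
    exists Phi1 => // -[]; first by rewrite addTb negbK.
    by rewrite addFb /eps; exact: (@medial_aut_toggle _ _ _ true).
  move=> i C D aCD _ _ [C' fC' CE].
  by have [D' [_ fD' _ _] DE] := medial_aut_step df aCD fC' CE; exists D'.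
have /choice[phi phiP] Psi : exists Psi', is_flag Psi -> is_flag Psi' /\
    forall b, f @` mflag Psi b = mflag Psi' (b (+) eps).
  by have [/ex[Psi' fP' PE]|nf] := pselect (is_flag Psi); [exists Psi'|exists Psi].
exists eps, phi; split=> [Psi fP|Psi b fP|i Psi Om aPO].
- by have [] := phiP _ fP.
- by have [_ PE] := phiP _ fP; exact: PE.
have [fP fO _ _] := aPO; have [fP' PE] := phiP _ fP; have [fO' OE] := phiP _ fO.
have [Om' aPO' OE'] := medial_aut_step df aPO fP' PE.
have [_ fOm' _ _] := aPO'.
suff -> : phi Om = Om' by [].
by have := OE true; rewrite OE' => /mflag_inj[].
Qed.

(** The maps induced by [f] and its inverse on the flags of P are mutually inverse with the same
    [eps], so [flag_map_ext] yields [g]; one flag then suffices to compare. *)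
Lemma medial_ext_surj f : isdual f = false -> exists g, medial_ext g = f.
Proof.
move=> df; have dfV : isdual f^-1%g = false by rewrite isdualV.
have [eps [phi [fphi phiE aphi]]] := medial_aut_flags df.
have [eps' [psi [fpsi psiE apsi]]] := medial_aut_flags dfV.
have e1 Psi b : is_flag Psi -> psi (phi Psi) = Psi /\ b (+) eps (+) eps' = b.
  move=> fP; have := image_extK f (mflag Psi b).
  rewrite phiE // psiE; last exact: fphi.
  by apply: mflag_inj => //; apply/fpsi/fphi.
have e2 Psi b : is_flag Psi -> phi (psi Psi) = Psi /\ b (+) eps' (+) eps = b.
  move=> fP; have := image_extVK f (mflag Psi b).
  rewrite psiE // phiE; last exact: fpsi.
  by apply: mflag_inj => //; apply/fphi/fpsi.
have [|Phi [fPhi _]] := @flag_extend _ P set0; first by [].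
have epsE : eps' = eps by have [_] := e1 _ true fPhi; case: (eps) (eps') => [] [].
rewrite epsE in apsi.
have [||g [dg gE]] := flag_map_ext fphi fpsi _ _ aphi apsi.
- by move=> A fA; case: (e1 A true fA).
- by move=> A fA; case: (e2 A true fA).
exists g; apply: (@ext_eq 3 (medial P) _ _ (mflag Phi true)).
- exact: mflag_is_flag.
- by rewrite df isdual_medial_ext.
by rewrite medial_ext_mflag // gE // dg phiE.
Qed.

End MedialExt.

(** * The group generated by kappa_1 and kappa_2 *)

Section Orders.
Local Open Scope group_scope.

Lemma has_orderV (G : groupType) (x : G) m : has_order x m -> has_order x^-1 m.
Proof.
move=> ox k; rewrite -ox expVgn; split=> [e|->]; last by rewrite invg1.
by rewrite -[x ^+ k]invgK e invg1.
Qed.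

Lemma has_order2 (G : groupType) (x : G) : x <> 1 -> x * x = 1 -> has_order x 2.
Proof.
move=> x1 xx k; rewrite -[k in x ^+ k](odd_double_half k) dvdn2 expgnDr -mul2n expgnA.
rewrite expgS expg1 xx expg1n mulg1.
by case: odd => /=; rewrite ?expg1 ?expg0.
Qed.

Lemma has_order_inj (G H : groupType) (f : G -> H) (x : G) m :
  {morph f : x y / x * y} -> f 1 = 1 -> injective f -> has_order x m ->
  has_order (f x) m.
Proof.
move=> fM f1 finj ox k; rewrite -ox.
have -> : f x ^+ k = f (x ^+ k) by elim: k => [|k IH]; rewrite ?expg0 // !expgS fM IH.
by rewrite -{1}f1; split=> [/finj|->].
Qed.

(** Odd powers of a duality are dualities, so only even powers can be trivial. *)
Lemma has_order_dual n (P : polytope n) (g : extgroup P) m : isdual g ->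
  has_order (g * g) m -> has_order g (2 * m).
Proof.
move=> dg ogg k.
have dk l : isdual (g ^+ l) = odd l.
  by elim: l => [|l IH]; rewrite ?expg0 ?isdual1 // expgS isdualM dg IH.
have ggE l : (g * g) ^+ l = g ^+ (2 * l) by rewrite expgnA expgS expg1.
split=> [gk|/dvdnP[l ->]].
  have ok : ~~ odd k by rewrite -dk gk isdual1.
  have kE : k = (2 * k./2)%N by rewrite mul2n even_halfK.
  by rewrite kE dvdn_pmul2l //; apply/ogg; rewrite ggE -kE.
by rewrite mulnCA -ggE; apply/ogg/dvdn_mull.
Qed.

End Orders.

(** * Flag-transitive subgroups of the extended group *)

Section Generation.
Context {n : nat} {P : polytope n}.
Implicit Types (g h : extgroup P) (A B : set P).

Lemma aut_adj_flag g A (m : nat) : isdual g = false -> is_flag A -> (m < n)%N ->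
  g @` adj_flag A m = adj_flag (g @` A) m.
Proof. by move=> dg fA mn; rewrite -adj_flag_ext // dg. Qed.

Lemma dual_adj_flag g A (m : nat) : isdual g -> is_flag A -> (m < n)%N ->
  g @` adj_flag A m = adj_flag (g @` A) (n.-1 - m)%N.
Proof. by move=> dg fA mn; rewrite -adj_flag_ext // dg. Qed.

(* An automorphism or duality [h] carries the flags adjacent to [A] to those
   adjacent to [h A], so the set of flags [{h A | h in H}] is closed under
   adjacency. *)
Lemma closed_flag_transitive (H : set (extgroup P)) A B :
  group_closed [in H] -> is_flag A -> is_flag B ->
  (forall m : nat, (m < n)%N -> exists2 h, H h & h @` A = adj_flag A m) ->
  exists2 h, H h & h @` A = B.
Proof.
move=> cH fA fB HA; have [H1 _] := cH; have HM := group_closedM cH.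
apply: (@flag_ind _ _ (fun B => exists2 h, H h & h @` A = B) A) => //.
  by exists 1%g; [rewrite inE in H1|rewrite image_ext1].
move=> i C D aCD _ _ [h Hh hA]; have bi := adjacent_range aCD.
pose m := absz i; have iE : i = m%:Z by rewrite /m; lia.
have mn : (m < n)%N by lia.
rewrite iE in aCD; rewrite -(adj_flag_eq aCD) -hA.
pose m' := (if isdual h then n.-1 - m else m)%N.
have m'n : (m' < n)%N by rewrite /m'; case: ifP; lia.
have [g Hg gA] := HA m' m'n.
exists (g * h)%g.
  by have := HM g h; rewrite !inE; exact.
rewrite image_ext_mul gA -adj_flag_ext //; congr adj_flag.
by rewrite /m'; case: (isdual h); lia.
Qed.

(** Some [h] in [H] takes [A] where [g] does. Were they of different kinds, [g * h^-1] would be a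
    duality fixing [A]; so they coincide by [ext_eq]. *)
Lemma closed_flag_full (H : set (extgroup P)) A :
  group_closed [in H] -> is_flag A ->
  (forall g, isdual g -> g @` A <> A) ->
  (forall m : nat, (m < n)%N -> exists2 h, H h & h @` A = adj_flag A m) ->
  H = setT.
Proof.
move=> cH fA ndual HA; apply/seteqP; split=> // g _.
have [h Hh hA] := closed_flag_transitive cH fA (ext_is_flag g fA) HA.
suff -> : g = h by [].
apply: (ext_eq fA) => //; have := ndual (g * h^-1)%g.
rewrite isdualM isdualV image_ext_mul -hA image_extK.
by case: (isdual g) (isdual h) => [] [] // /(_ isT).
Qed.

End Generation.

(** An automorphism of M between flags with the same edge bit comes from an automorphism of P, not a
    duality, so regularity of M would descend to P. *)
Lemma medial_chiral (P : polytope 4) (A : set (medial P)) s :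
  ~ regular P -> distinguished A s -> chiral (medial P).
Proof.
move=> nreg dAs; split=> // [reg|]; last by exists A, s.
apply: nreg => B C fB fC.
have [f /aut_isdual df fBC] : same_orbit (mflag B true : set (medial P)) (mflag C true).
  by apply: reg; exact: mflag_is_flag.
have [g gf] := medial_ext_surj df.
move: fBC; rewrite -gf medial_ext_mflag // => /mflag_inj[].
- exact: ext_is_flag.
- by [].
by move=> gBC dg; exists g => //; apply/aut_isdualP; case: isdual dg.
Qed.

Theorem theorem1 (P : polytope 4) (p q : nat) (Phi : set P)
    (sigma : nat -> extgroup P) (delta : extgroup P) :
  chiral P -> improperly_self_dual P ->
  distinguished Phi sigma -> has_type sigma [:: p; q; p] ->
  is_duality delta -> (delta @` Phi)%classic = adj_flag Phi 0 ->
  let kappa1 := delta in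
  let kappa2 := (sigma 1%N * sigma 2%N * delta^-1)%g in
  let Lambda := generated [set kappa1; kappa2]%classic in
  (exists M : polytope 3,
     [/\ chiral M, has_hole_type M 4 (2 * q) p &
         group_isomorphic Lambda (autgroup M)]) /\
  Lambda = [set: extgroup P]%classic.
Proof.
move=> [_ nreg _] [_ improper] [fPhi dist] [_ type] /isdualP ddelta deltaPhi.
move=> kappa1 kappa2 Lambda.
have dsig m : (0 < m < 4)%N -> isdual (sigma m) = false.
  by move=> /dist[/aut_isdual].
have sigPhi m : (0 < m < 4)%N -> sigma m @` Phi = adj_flag (adj_flag Phi m) m.-1.
  by case/dist.
have fa (A : set P) m : is_flag A -> (m < 4)%N -> is_flag (adj_flag A m).
  exact: adj_flag_is_flag.
have sig1Phi : sigma 1%N @` Phi = adj_flag (adj_flag Phi 1) 0 := sigPhi 1%N isT.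
have sig2Phi : sigma 2%N @` Phi = adj_flag (adj_flag Phi 2) 1 := sigPhi 2%N isT.
have sig3Phi : sigma 3%N @` Phi = adj_flag (adj_flag Phi 3) 2 := sigPhi 3%N isT.
have [f0 f1] := (fa Phi 0%N fPhi isT, fa Phi 1%N fPhi isT).
have [f2 f3] := (fa Phi 2%N fPhi isT, fa Phi 3%N fPhi isT).
(* Phi^3 delta = (Phi delta)^0 = Phi^{0,0} = Phi. *)
have deltaVPhi : ext_fun delta^-1%g @` Phi = adj_flag Phi 3.
  apply: (can_inj (image_extK delta)); rewrite image_extVK.
  by rewrite dual_adj_flag // deltaPhi adj_flagK.
(* Phi sigma_1 sigma_2 = (Phi sigma_2)^{1,0} = Phi^{2,1,1,0} = Phi^{2,0}, which delta^-1 sends to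
   (Phi delta^-1)^{1,3} = Phi^{3,1,3} = Phi^1. *)
have kappa2Phi : ext_fun kappa2 @` Phi = adj_flag Phi 1.
  rewrite /kappa2 !image_ext_mul sig1Phi.
  rewrite !(aut_adj_flag (dsig 2%N isT)) // sig2Phi (adj_flagK f2) //.
  rewrite !dual_adj_flag ?isdualV // deltaVPhi.
  by rewrite -(@adj_flagC _ _ Phi 1 3) // adj_flagK.
have dkappa2 : isdual kappa2 by rewrite /kappa2 !isdualM isdualV !dsig ?ddelta.
have kappa2VPhi : ext_fun kappa2^-1%g @` Phi = adj_flag Phi 2.
  apply: (can_inj (image_extK kappa2)); rewrite image_extVK.
  by rewrite dual_adj_flag // kappa2Phi adj_flagK.
(* Phi kappa_2^2 = Phi^{1,2}, and sigma_2 sends this to Phi^{2,1,1,2} = Phi. *)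
have sqr2 : (kappa2 * kappa2 = (sigma 2)^-1)%g.
  apply: (ext_eq fPhi); first by rewrite isdualM isdualV dsig // addbb.
  apply: (can_inj (image_extK (sigma 2%N))); rewrite image_extVK image_ext_mul.
  rewrite kappa2Phi dual_adj_flag // kappa2Phi !(aut_adj_flag (dsig 2%N isT)) //.
  by rewrite sig2Phi (adj_flagK f2) // adj_flagK.
(* Phi kappa_1 kappa_2^-1 = (Phi kappa_2^-1)^3 = Phi^{2,3}, and sigma_3 sends this to Phi^{3,2,2,3}
   = Phi. *)
have hole : (kappa1 * kappa2^-1 = (sigma 3)^-1)%g.
  apply: (ext_eq fPhi); first by rewrite isdualM !isdualV dsig // dkappa2 ddelta.
  apply: (can_inj (image_extK (sigma 3%N))); rewrite image_extVK image_ext_mul.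
  rewrite deltaPhi dual_adj_flag ?isdualV // kappa2VPhi.
  by rewrite !(aut_adj_flag (dsig 3%N isT)) // sig3Phi (adj_flagK f3) // adj_flagK.
have sqr1Phi : ext_fun (kappa1 * kappa1)%g @` Phi = adj_flag (adj_flag Phi 0) 3.
  by rewrite image_ext_mul deltaPhi dual_adj_flag // deltaPhi.
(* If Phi^{0,3} were Phi, then Phi^0 = Phi^3, but only Phi^3 keeps the vertex of Phi. The square is
   trivial because 0-steps and 3-steps commute. *)
have order1 : has_order (kappa1 * kappa1)%g 2.
  apply: has_order2 => [e|].
    move: sqr1Phi; rewrite e image_ext1 => PhiE.
    have a0 := adj_flagP fPhi (isT : (0 < 4)%N).
    have a3 := adj_flagP fPhi (isT : (3 < 4)%N).
    have e03 : adj_flag Phi 0 = adj_flag Phi 3 by rewrite {2}PhiE adj_flagK.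
    have [|F PhiF rF] := @flag_rank_ex _ _ Phi 0 fPhi; first by [].
    have F3 : adj_flag Phi 3 F by case: a3 => _ _ _ /(_ F) h; apply/h; rewrite ?rF.
    by rewrite -e03 in F3; have := adjacent_rank a0 PhiF F3; rewrite rF.
  apply: (ext_eq fPhi); first by rewrite !isdualM isdual1 ddelta.
  have fk : is_flag (kappa1 @` Phi) by exact: ext_is_flag.
  have fk3 := fa _ 3%N fk isT.
  rewrite image_ext_mul sqr1Phi image_ext1 image_ext_mul !dual_adj_flag ?fa //.
  rewrite deltaPhi dual_adj_flag // deltaPhi.
  by rewrite (@adj_flagC _ _ Phi 0 3) // (adj_flagK f3) // adj_flagK.
have LambdaT : Lambda = setT.
  apply/seteqP; split=> // g _ H [cH subH].
  have H1 : H kappa1 by apply: subH; left.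
  have H2 : H kappa2 by apply: subH; right.
  have HV h : H h -> H h^-1%g.
    by move=> Hh; have := group_closedV cH (mem_set Hh); rewrite inE.
  suff -> : H = setT by [].
  (* A duality fixing Phi would keep it in its own orbit, via the identity, against improper
     self-duality. *)
  apply: (closed_flag_full cH fPhi) => [h /isdualP dh hPhi|].
    apply: (improper h dh Phi fPhi); exists 1%g; last by rewrite hPhi image_ext1.
    by apply/aut_isdualP; rewrite isdual1.
  case=> [|[|[|[|//]]]] _.
  - by exists kappa1.
  - by exists kappa2.
  - by exists kappa2^-1%g; first exact: HV.
  - by exists kappa1^-1%g; first exact: HV.
split=> //; exists (medial P).
pose A : set (medial P) := mflag Phi true.
pose s m : extgroup (medial P) := medial_ext (if m == 1%N then kappa1 else kappa2).
have fA : is_flag A by exact: mflag_is_flag.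
have medial_order g m : has_order g m -> has_order (medial_ext g) m.
  by apply: has_order_inj medial_extM medial_ext1 medial_ext_inj.
have medial_extV g : medial_ext g^-1%g = (medial_ext g)^-1%g.
  by apply: (mulgI (medial_ext g)); rewrite -medial_extM !mulgV medial_ext1.
have step m (mn : (m < 4)%N) := mflag_adjacent (adj_flagP fPhi mn).
have adjE (m : nat) (B C : set (medial P)) :
    adjacent (@medial_rank P) m%:Z B C -> adj_flag B m = C.
  exact: (@adj_flag_eq 3 (medial P)).
have dA : distinguished A s.
  apply: distinguished_intro => // m m3; split; first by rewrite isdual_medial_ext.
  (* From the base edge (F_0, F_2), toggling and then changing F_0 gives A^{1,0}, over Phi^0;
     changing F_1 and then toggling gives A^{2,1}, over Phi^1. *)
  have [->|->] : m = 1%N \/ m = 2%N by lia.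
    rewrite /s /= medial_ext_mflag // ddelta deltaPhi /=.
    rewrite (adjE 1%N A _ (mflag_toggle true fPhi)).
    by rewrite (adjE 0%N _ _ (step 0%N isT)).
  rewrite /s /= medial_ext_mflag // dkappa2 kappa2Phi /=.
  rewrite (adjE 2%N A _ (step 1%N isT)).
  by rewrite (adjE 1%N _ _ (mflag_toggle true _)) //; exact: fa.
split.
- exact: medial_chiral dA.
- exists A, s; split=> //.
    (* Both orders are twice those of the squares: 4 = 2 * 2, and 2 * q because kappa_2^2 =
       sigma_2^-1. *)
    split=> // -[|[|//]] _ /=; apply: medial_order.
      exact: has_order_dual order1.
    by apply: has_order_dual => //; rewrite sqr2; exact/has_orderV/(type 1%N).
  rewrite /s /= -medial_extV -medial_extM hole; apply/medial_order/has_orderV.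
  exact: (type 2%N).
- rewrite LambdaT; exists medial_ext; split.
    by move=> g h _ _; exact: medial_extM.
  split=> [g _|g h _ _|f /aut_isdual/medial_ext_surj[g <-]].
  + exact: medial_ext_is_aut.
  + exact: medial_ext_inj.
  + by exists g.
Qed.
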